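(* Let $n,d\in\mathbb{N}$, $\alpha\in(0,1]$, $\tilde\alpha\ge0$, let $J$ be a real symmetric $n\times n$ matrix with $J_{ii}=0$ and $\max_i\sum_j|J_{ij}|\le1-\alpha$, let $h\in\mathbb{R}^n$ with $\|h\|_\infty\le\tilde\alpha$, and let $q^n$ be the probability measure on $\{-1,+1\}^n$ proportional to $\exp\big(\tfrac12\sum_{i,j}J_{ij}\sigma_i\sigma_j+\sum_i h_i\sigma_i\big)$. Let $f:\{-1,+1\}^n\to\mathbb{R}$ satisfy \[ \|\mathfrak{h}^{(k)}f\|_2\le 1\quad\text{for all }k=1,\ldots,d-1,\qquad \|\mathfrak{h}^{(d)}f\|_\infty\le1 . \] Then there exists a constant $C=C(\alpha,\tilde\alpha,d)>0$ (not depending on $n$ or $f$) such that \[ \mathbb{E}_{q^n}\exp\big(C|f-\mathbb{E}_{q^n}f|^{2/d}\big)\le 2, \] and in particular $q^n(|f-\mathbb{E}_{q^n}f|\ge t)\le 2\exp(-Ct^{2/d})$ for all $t>0$.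
   Context: For $\sigma\in\{-1,+1\}^n$, $T_i\sigma$ is $\sigma$ with the $i$-th coordinate flipped. For $g:\{-1,+1\}^n\to\mathbb{R}$ set $\mathfrak{h}_ig(\sigma)=\frac{1}{\sqrt2}|g(\sigma)-g(T_i\sigma)|$, and iteratively $\mathfrak{h}_{i_1\ldots i_d}g=\mathfrak{h}_{i_1}(\mathfrak{h}_{i_2\ldots i_d}g)$. $\mathfrak{h}^{(d)}f(\sigma)$ is the tensor $(\mathfrak{h}_{i_1\ldots i_d}f(\sigma))_{i_1,\ldots,i_d\in\{1,\ldots,n\}}$ and $|\mathfrak{h}^{(d)}f|(\sigma)$ its Euclidean norm. $\|\mathfrak{h}^{(d)}f\|_p=(\mathbb{E}_{q^n}|\mathfrak{h}^{(d)}f|^p)^{1/p}$ and $\|\cdot\|_\infty$ is the maximum over the support of $q^n$. *)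

(* Defs.v *)
From HB Require Import structures.
From mathcomp Require Import all_boot all_order all_algebra.
From mathcomp Require Import reals.
From mathcomp.analysis Require Import sequences exp.
Set Implicit Arguments. Unset Strict Implicit. Unset Printing Implicit Defensive.
Import Order.TTheory GRing.Theory Num.Theory.
Local Open Scope ring_scope.

Section Defs.
Variable R : realType.
Variable n : nat.

Definition cube := {ffun 'I_n -> bool}.

Definition spin (s : cube) (i : 'I_n) : R := if s i then 1 else -1.

Definition flip (i : 'I_n) (s : cube) : cube :=
  [ffun j => if j == i then ~~ s j else s j].

Definition hdiff (i : 'I_n) (g : cube -> R) : cube -> R :=
  fun s => `|g s - g (flip i s)| / Num.sqrt 2.

Definition hiter (idx : seq 'I_n) (g : cube -> R) : cube -> R :=
  foldr hdiff g idx.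

Definition hnorm (d : nat) (f : cube -> R) (s : cube) : R :=
  Num.sqrt (\sum_(t : d.-tuple 'I_n) (hiter t f s) ^+ 2).

Definition ising_weight (J : 'M[R]_n) (h : 'I_n -> R) (s : cube) : R :=
  expR (2^-1 * (\sum_i \sum_j J i j * spin s i * spin s j)
        + \sum_i h i * spin s i).

Definition Eq (J : 'M[R]_n) (h : 'I_n -> R) (g : cube -> R) : R :=
  (\sum_s ising_weight J h s * g s) / (\sum_s ising_weight J h s).

Definition Pq (J : 'M[R]_n) (h : 'I_n -> R) (A : pred cube) : R :=
  (\sum_(s | A s) ising_weight J h s) / (\sum_s ising_weight J h s).

Definition hL2 (J : 'M[R]_n) (h : 'I_n -> R) (d : nat) (f : cube -> R) : R :=
  Num.sqrt (Eq J h (fun s => hnorm d f s ^+ 2)).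

(* || h^{(d)} f ||_infty : maximum over the support of q^n, which is the
   whole cube since all weights are positive *)
Definition hLinf (d : nat) (f : cube -> R) : R :=
  \big[Num.max/0]_s hnorm d f s.

End Defs.

(* Main.v *)
Require Import Defs.
From HB Require Import structures.
From mathcomp Require Import all_boot all_order all_algebra.
From mathcomp Require Import ring lra.
From mathcomp Require Import reals.
From mathcomp.analysis Require Import topology normedtype sequences derive realfun exp.
Import Order.TTheory GRing.Theory Num.Theory.
Import numFieldNormedType.Exports.
Local Open Scope ring_scope.

Set Implicit Arguments.
Unset Strict Implicit.
Unset Printing Implicit Defensive.

(** The measure satisfies a logarithmic Sobolev inequality
    [Ent (u^2) <= C * E (sum_i (D_i u)^2)] with [C] depending only on [alpha] and [alpha'].
    This is proved by induction on the number of free spins (Marton): averaging the chain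
    rule for the entropy over the spin [i] that is revealed first, one has to bound the sum
    over [i] of the entropies of the one-spin marginals, hence the squared differences of
    the marginals of [u^2 q] and [q].  Duality with Lipschitz vectors and the contraction of
    the Glauber dynamics under Dobrushin's condition bound these by the conditional
    one-spin differences, that is, by the energy.

    Jensen's inequality turns the logarithmic Sobolev inequality, applied to [u = |g|^p],
    into the doubling estimate [|g|_{2p}^2 <= |g|_p^2 + c p |Dg|_{2p}^2] of L^p norms.
    Along dyadic [p] this gives [|g|_p^2 <= |g|_2^2 + 2 c p |Dg|_p^2].  Since the gradient of
    [|h^(k) f|] is at most [|h^(k+1) f|], iterating [d] times yields
    [|f - E f|_p <= (K p)^(d/2)], and the exponential series concludes. *)

(** * Weighted Cauchy-Schwarz inequality and Schur's test *)

Section WeightedSums.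
Context {R : realType} {I : finType}.
Implicit Types (P : pred I) (c a b : I -> R).

(** Lagrange's identity: twice the deficit is a double sum of squares with weights [c i * c j]. *)
Lemma cauchy_schwarz_sum P c a b : (forall i, P i -> 0 <= c i) ->
  (\sum_(i | P i) c i * a i * b i) ^+ 2 <=
  (\sum_(i | P i) c i * a i ^+ 2) * (\sum_(i | P i) c i * b i ^+ 2).
Proof.
move=> c0.
set X := \sum_(i | P i) c i * a i ^+ 2; set Y := \sum_(i | P i) c i * b i ^+ 2.
set Z := \sum_(i | P i) c i * a i * b i.
suff : 0 <= (X * Y - Z ^+ 2) *+ 2 by rewrite pmulrn_lge0// subr_ge0.
have -> : (X * Y - Z ^+ 2) *+ 2 = \sum_(i | P i) \sum_(j | P j)
    c i * c j * (a i * b j - a j * b i) ^+ 2.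
  have -> : (X * Y - Z ^+ 2) *+ 2 = X * Y + Y * X - Z * Z - Z * Z by ring.
  rewrite !big_distrlr /= -big_split -!sumrB /=; apply: eq_bigr => i _.
  rewrite -big_split -!sumrB /=; apply: eq_bigr => j _; ring.
apply: sumr_ge0 => i Pi; apply: sumr_ge0 => j Pj.
by rewrite mulr_ge0 ?sqr_ge0// mulr_ge0// c0.
Qed.

(** Cauchy-Schwarz with weights [B i j] spends one factor [rho] on the row sums; after exchanging
    the sums, the column sums give the other one. *)
Lemma schur_test P (B : I -> I -> R) (x : I -> R) (rho : R) : 0 <= rho ->
  (forall i j, 0 <= B i j) ->
  (forall i, P i -> \sum_(j | P j) B i j <= rho) ->
  (forall j, P j -> \sum_(i | P i) B i j <= rho) ->
  \sum_(i | P i) (\sum_(j | P j) B i j * x j) ^+ 2 <=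
  rho ^+ 2 * \sum_(i | P i) x i ^+ 2.
Proof.
move=> rho0 B0 rowB colB.
apply: (@le_trans _ _ (\sum_(i | P i) rho * \sum_(j | P j) B i j * x j ^+ 2)).
  apply: ler_sum => i Pi.
  have := @cauchy_schwarz_sum P (B i) (fun=> 1) x (fun j _ => B0 i j).
  under eq_bigr do rewrite mulr1.
  under [X in _ <= X * _ -> _]eq_bigr do rewrite expr1n mulr1.
  move=> /le_trans; apply; apply: ler_wpM2r; last exact: rowB.
  by apply: sumr_ge0 => j _; rewrite mulr_ge0 ?sqr_ge0.
rewrite -mulr_sumr exprS expr1 -mulrA ler_wpM2l// exchange_big /= mulr_sumr.
apply: ler_sum => j Pj; rewrite -mulr_suml ler_wpM2r ?sqr_ge0//.
exact: colB.
Qed.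

End WeightedSums.

(** * Subcubes *)

Section Subcubes.
Context {n : nat}.
Implicit Types (S : {set 'I_n}) (s t : cube n) (i j : 'I_n).

Lemma flipE i s j : flip i s j = if j == i then ~~ s j else s j.
Proof. by rewrite /flip ffunE. Qed.

Lemma flipK i : involutive (flip i).
Proof. by move=> s; apply/ffunP => j; rewrite !flipE; case: eqP => // _; rewrite negbK. Qed.

Lemma flipC i j s : flip i (flip j s) = flip j (flip i s).
Proof. by apply/ffunP => k; rewrite !flipE; do 2!case: eqP. Qed.

(** The subcube through [t] whose free spins are those in [S]. Conditioning on the other spins
    becomes summing over this predicate, so the induction on the number of free spins stays inside
    the type [cube n]. *)
Definition agree S t : pred (cube n) := fun s => [forall i, (i \notin S) ==> (s i == t i)].

Lemma agreeP S t s : reflect (forall i, i \notin S -> s i = t i) (agree S t s).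
Proof.
apply: (iffP forallP) => [st i iS|st i]; first exact: (eqP (implyP (st i) iS)).
by apply/implyP => iS; apply/eqP/st.
Qed.

Lemma agree_refl S t : agree S t t.
Proof. exact/agreeP. Qed.

Lemma agree_setT t s : agree setT t s.
Proof. by apply/agreeP => i; rewrite inE. Qed.

Lemma agree_set0 t s : agree set0 t s = (s == t).
Proof.
apply/agreeP/eqP => [st|-> //]; apply/ffunP => i; apply: st; by rewrite inE.
Qed.

Lemma agree_flip S t s i : i \in S -> agree S t (flip i s) = agree S t s.
Proof.
move=> iS; apply/agreeP/agreeP => st j jS; have := st j jS; rewrite flipE;
  by case: eqP => // ji; rewrite -ji (negbTE jS) in iS.
Qed.

Lemma agreeD1 S t s i : i \in S ->
  agree (S :\ i) t s = agree S t s && (s i == t i).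
Proof.
move=> iS; apply/agreeP/andP => [st|[/agreeP st /eqP sti] j].
  split; last by apply/eqP/st; rewrite !inE eqxx.
  by apply/agreeP => j jS; apply: st; rewrite !inE negb_and jS orbT.
by rewrite !inE negb_and negbK => /orP[/eqP ->|/st].
Qed.

Lemma agreeD1_flip S t s i : i \in S ->
  agree (S :\ i) (flip i t) s = agree S t s && (s i != t i).
Proof.
move=> iS; rewrite agreeD1// flipE eqxx; congr andb.
  by apply/agreeP/agreeP => st j jS; have := st j jS; rewrite flipE;
    case: eqP => // ji; rewrite -ji (negbTE jS) in iS.
by case: (s i) (t i) => [] [].
Qed.

Lemma agreeD1_flipr S t s i : i \in S ->
  agree (S :\ i) (flip i t) (flip i s) = agree (S :\ i) t s.
Proof.
by move=> iS; rewrite agreeD1_flip// agreeD1// agree_flip// flipE eqxx;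
  case: (s i) (t i) => [] [].
Qed.

Context {R : realType}.
Implicit Types (G : cube n -> R).

Lemma sum_flip S t i G : i \in S ->
  \sum_(s | agree S t s) G (flip i s) = \sum_(s | agree S t s) G s.
Proof.
move=> iS; rewrite [RHS](reindex_inj (inv_inj (flipK i))) /=.
by apply: eq_bigl => s; rewrite agree_flip.
Qed.

Lemma sum_split S t i G : i \in S ->
  \sum_(s | agree S t s) G s =
  \sum_(s | agree (S :\ i) t s) G s + \sum_(s | agree (S :\ i) (flip i t) s) G s.
Proof.
move=> iS; rewrite (bigID (fun s : cube n => s i == t i)) /=.
by congr (_ + _); apply: eq_bigl => s; [rewrite agreeD1|rewrite agreeD1_flip].
Qed.

Lemma sum_flip_half S t i G : i \in S ->
  \sum_(s | agree (S :\ i) (flip i t) s) G s =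
  \sum_(s | agree (S :\ i) t s) G (flip i s).
Proof.
move=> iS; rewrite (reindex_inj (inv_inj (flipK i))) /=.
by apply: eq_bigl => s; rewrite agreeD1_flipr.
Qed.

Definition diff i G : cube n -> R := fun s => G s - G (flip i s).

(** A path from [s] to [t] flips each spin of [S] at most once, and the increments of [G] telescope
    along it. *)
Lemma diff_path S t s (L : 'I_n -> R) G :
  (forall i s, i \in S -> `|diff i G s| <= L i) -> agree S t s ->
  `|G s - G t| <= \sum_(i in S) L i.
Proof.
elim: {S}#|S| {-2}S (leqnn #|S|) s => [|m IH] S.
  rewrite leqn0 cards_eq0 => /eqP -> s _.
  by rewrite agree_set0 => /eqP ->; rewrite subrr normr0 big_set0.
move=> Sm s DL.
have [->|[i iS]] := set_0Vmem S.
  by rewrite agree_set0 => /eqP ->; rewrite subrr normr0 big_set0.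
move=> st; rewrite (big_setD1 i)//=.
have Sm' : (#|S :\ i| <= m)%N by move: Sm; rewrite (cardsD1 i) iS.
have DL' j s' : j \in S :\ i -> `|diff j G s'| <= L j.
  by rewrite !inE => /andP[_ jS]; exact: DL.
have [sti|sti] := eqVneq (s i) (t i).
  have := IH _ Sm' s DL'; rewrite agreeD1// st sti eqxx => /(_ isT) /le_trans.
  by apply; rewrite lerDr (le_trans _ (DL i s iS)).
have := IH _ Sm' (flip i s) DL'; rewrite agreeD1// agree_flip// st /= flipE eqxx.
have -> : (~~ s i == t i) by move: sti; case: (s i) (t i) => [] [].
move=> /(_ isT) H.
have -> : G s - G t = diff i G s + (G (flip i s) - G t) by rewrite /diff; ring.
by rewrite (le_trans (ler_normD _ _))// lerD// DL.
Qed.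

End Subcubes.

(** * Glauber dynamics *)

Section Glauber.
Context {R : realType} {n : nat}.
Variable w : cube n -> R.
Hypothesis w_gt0 : forall s, 0 < w s.
Implicit Types (S : {set 'I_n}) (s t : cube n) (i j : 'I_n) (g F : cube n -> R).

(* [rate j s] is the conditional probability, given all spins of [s] but the
   [j]-th, that the [j]-th spin is the opposite of [s j]. *)
Definition rate j s : R := w (flip j s) / (w s + w (flip j s)).

(* The conditional expectation of [g] given all spins but the [j]-th. *)
Definition resample j g : cube n -> R := fun s => g s - rate j s * diff j g s.

(** One step of heat-bath dynamics on the free spins, in generator form: [glauberE] rewrites it as
    resampling a uniformly chosen spin of [S]. *)
Definition glauber S g : cube n -> R :=
  fun s => g s - #|S|%:R^-1 * \sum_(j in S) rate j s * diff j g s.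

Lemma rate_gt0 j s : 0 < rate j s.
Proof. by rewrite divr_gt0// addr_gt0. Qed.

Lemma rate_ge0 j s : 0 <= rate j s. Proof. exact/ltW/rate_gt0. Qed.

Lemma rate_flip j s : rate j (flip j s) = 1 - rate j s.
Proof.
have := w_gt0 s; have := w_gt0 (flip j s); rewrite /rate flipK => h1 h2.
by field; rewrite !gt_eqF ?addr_gt0.
Qed.

Lemma rate_le1 j s : rate j s <= 1.
Proof. by rewrite -subr_ge0 -rate_flip rate_ge0. Qed.

Lemma detailed_balance j s : w (flip j s) * rate j (flip j s) = w s * rate j s.
Proof.
rewrite /rate flipK addrC.
by rewrite mulrCA mulrA.
Qed.

(** Flipping spin [j] in the sum preserves the weight [w s * rate j s] by detailed balance and
    changes the sign of [diff j g]; averaging the two forms of the sum symmetrises it. *)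
Lemma dirichlet_form S t j F g : j \in S ->
  \sum_(s | agree S t s) w s * F s * (rate j s * diff j g s) =
  2^-1 * \sum_(s | agree S t s) w s * rate j s * (diff j F s * diff j g s).
Proof.
move=> jS; set X := LHS.
suff -> : \sum_(s | agree S t s) w s * rate j s * (diff j F s * diff j g s) = X + X.
  by field.
have XE : X = \sum_(s | agree S t s) w (flip j s) * rate j (flip j s) *
    (F (flip j s) * (g (flip j s) - g s)).
  rewrite /X -(sum_flip _ _ jS); apply: eq_bigr => s _; rewrite /diff flipK; ring.
rewrite {2}XE /X -big_split /=; apply: eq_bigr => s _; rewrite /diff.
rewrite detailed_balance; ring.
Qed.

Lemma diff_resample_same i g s : diff i (resample i g) s = 0.
Proof. rewrite /diff /resample rate_flip /diff flipK; ring. Qed.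

(** The first two terms are a convex combination of differences of [g]; the last one is the
    influence of spin [i] on the law of spin [j], which Dobrushin's condition controls. *)
Lemma diff_resample i j g s :
  diff i (resample j g) s =
    (1 - rate j s) * diff i g s + rate j s * diff i g (flip j s)
    + (rate j (flip i s) - rate j s) * diff j g (flip i s).
Proof. rewrite /diff /resample /diff (flipC j i); ring. Qed.

Lemma glauberE S g s : (0 < #|S|)%N ->
  glauber S g s = #|S|%:R^-1 * \sum_(j in S) resample j g s.
Proof.
move=> S0; rewrite sumrB mulrBr sumr_const -[g s *+ _]mulr_natl mulrA mulVf ?mul1r//.
by rewrite pnatr_eq0 -lt0n.
Qed.

Context (A : 'I_n -> 'I_n -> R) (alpha : R).
Hypothesis alpha_gt0 : 0 < alpha.
Hypothesis alpha_le1 : alpha <= 1.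
Hypothesis A_ge0 : forall i j, 0 <= A i j.
Hypothesis A_sym : forall i j, A i j = A j i.
Hypothesis A_row : forall i, \sum_j A i j <= 1 - alpha.
Hypothesis rate_lip : forall i j s, i != j ->
  `|rate j (flip i s) - rate j s| <= A i j.

(** Resampling [i] itself erases the dependence on spin [i], while resampling another [j] costs at
    most [L i + A i j * L j]. Averaging over [S] gives the matrix on the right. *)
Lemma glauber_lip S g (L : 'I_n -> R) : (forall i, 0 <= L i) ->
  (forall i s, i \in S -> `|diff i g s| <= L i) ->
  forall i s, i \in S -> `|diff i (glauber S g) s| <=
    \sum_(j in S) #|S|%:R^-1 * ((#|S|.-1%:R) * (i == j)%:R + A i j) * L j.
Proof.
move=> L0 gL i s iS.
have S0 : (0 < #|S|)%N by apply/card_gt0P; exists i.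
rewrite /diff !glauberE// -mulrBr -sumrB normrM ger0_norm ?invr_ge0//.
under [X in _ <= X]eq_bigr do rewrite -mulrA.
rewrite -mulr_sumr ler_wpM2l ?invr_ge0//.
apply: (@le_trans _ _ (\sum_(j in S) ((i != j)%:R * L i + A i j * L j))).
  rewrite (le_trans (ler_norm_sum _ _ _))//; apply: ler_sum => j jS.
  have [<-|ij] := eqVneq i j.
    have := diff_resample_same i g s; rewrite {1}/diff => ->.
    by rewrite normr0 mul0r add0r mulr_ge0.
  have := diff_resample i j g s; rewrite {1}/diff => ->.
  rewrite mul1r (le_trans (ler_normD _ _))// lerD//; last first.
    by rewrite normrM ler_pM// ?rate_lip ?gL.
  rewrite (le_trans (ler_normD _ _))//.
  rewrite [X in X + _]normrM [X in _ + X]normrM (ger0_norm (rate_ge0 _ _)) ger0_norm ?subr_ge0 ?rate_le1//.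
  rewrite (_ : L i = (1 - rate j s) * L i + rate j s * L i); last by ring.
  by rewrite lerD// ler_wpM2l ?rate_ge0 ?subr_ge0 ?rate_le1// gL.
rewrite [X in _ <= X](_ : _ = #|S|.-1%:R * L i + \sum_(j in S) A i j * L j); last first.
  under eq_bigr do rewrite mulrDl; rewrite big_split /=; congr (_ + _).
  rewrite (bigD1 i)//= eqxx mulr1 big1 ?addr0// => j /andP[_ ji].
  by rewrite eq_sym (negbTE ji) mulr0 mul0r.
rewrite big_split /= lerD2r -mulr_suml ler_wpM2r//.
rewrite (bigD1 i)//= eqxx add0r (eq_bigr (fun=> 1)); last first.
  by move=> j /andP[_ ji]; rewrite eq_sym ji.
rewrite sumr_const ler_nat leq_eqVlt; apply/orP; left; apply/eqP.
rewrite [in RHS](cardD1 i) iS /=; apply: eq_card => j.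
by rewrite !inE andbC.
Qed.

(** Rows and, by symmetry of [A], columns of the matrix sum to at most
    [(#|S| - 1 + 1 - alpha) / #|S|], so Schur's test applies. *)
Lemma glauber_contraction S (L : 'I_n -> R) : (0 < #|S|)%N ->
  \sum_(i in S) (\sum_(j in S)
      #|S|%:R^-1 * (#|S|.-1%:R * (i == j)%:R + A i j) * L j) ^+ 2 <=
  (1 - alpha / #|S|%:R) ^+ 2 * \sum_(i in S) L i ^+ 2.
Proof.
move=> S0; have S0' : 0 < #|S|%:R :> R by rewrite ltr0n.
have row i : i \in S ->
    \sum_(j in S) #|S|%:R^-1 * (#|S|.-1%:R * (i == j)%:R + A i j) <=
    1 - alpha / #|S|%:R.
  move=> iS; rewrite -mulr_sumr ler_pdivrMl// mulrBr mulr1 mulrCA divff ?mulr1 ?gt_eqF//.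
  rewrite big_split /= -mulr_sumr (bigD1 i)//= eqxx big1 ?addr0 ?mulr1; last first.
    by move=> j /andP[_ ji]; rewrite eq_sym (negbTE ji).
  have -> : #|S|%:R = #|S|.-1%:R + 1 :> R by rewrite natr1 prednK.
  rewrite -addrA lerD2l (le_trans _ (A_row i))//.
  by rewrite [leRHS](bigID (mem S)) /= lerDl sumr_ge0.
apply: schur_test => //.
- rewrite subr_ge0 ler_pdivrMr// mul1r (le_trans alpha_le1)//.
  by rewrite ler1n.
- by move=> i j; rewrite mulr_ge0 ?invr_ge0// addr_ge0// mulr_ge0.
- move=> j jS; rewrite (le_trans _ (row j jS))//; apply: ler_sum => i _.
  by rewrite A_sym eq_sym.
Qed.

Section Tilt.
Context (S : {set 'I_n}) (t : cube n) (F : cube n -> R).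
Hypothesis F_ge0 : forall s, 0 <= F s.
Let M := \sum_(s | agree S t s) w s * F s.
Let Z := \sum_(s | agree S t s) w s.
Hypothesis M_gt0 : 0 < M.

Lemma subcube_mass_gt0 : 0 < Z.
Proof.
rewrite /Z (bigD1 t) ?agree_refl//= ltr_wpDr//.
by apply: sumr_ge0 => s _; apply: ltW.
Qed.

(** Expectation of [g] under the conditional measure tilted by the density [F], minus its
    expectation under the untilted one. Bounds over Lipschitz [g] measure the distance of the two by
    duality. *)
Definition mean_gap g : R :=
  (\sum_(s | agree S t s) w s * F s * g s) / M -
  (\sum_(s | agree S t s) w s * g s) / Z.

(** By [dirichlet_form], this times a Lipschitz constant of [g] in direction [j] bounds the change
    of the unnormalised tilted sum of [g] when spin [j] is resampled. *)
Definition tilt_flux j : R :=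
  2^-1 * \sum_(s | agree S t s) w s * rate j s * `|diff j F s|.

(** The untilted mean is invariant under the dynamics ([dirichlet_form] with a constant [F]), so
    only the tilted mean moves, by a Dirichlet form of [F] and [g]. *)
Lemma mean_gap_glauber g : (0 < #|S|)%N ->
  mean_gap g = mean_gap (glauber S g) + #|S|%:R^-1 * (\sum_(j in S)
    (2^-1 * \sum_(s | agree S t s) w s * rate j s * (diff j F s * diff j g s))) / M.
Proof.
move=> S0; rewrite /mean_gap.
have E (G : cube n -> R) : \sum_(s | agree S t s) G s * g s =
  \sum_(s | agree S t s) G s * glauber S g s + #|S|%:R^-1 *
   \sum_(j in S) \sum_(s | agree S t s) G s * (rate j s * diff j g s).
  rewrite exchange_big mulr_sumr -big_split /=; apply: eq_bigr => s _.
  by rewrite /glauber -mulr_sumr; ring.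
have E0 : \sum_(j in S) \sum_(s | agree S t s) w s * (rate j s * diff j g s) = 0.
  apply: big1 => j jS; under eq_bigr do rewrite -[w _]mulr1.
  rewrite (dirichlet_form t (fun=> 1) g jS) big1 ?mulr0// => s _.
  by rewrite [diff _ (fun=> 1) _]subrr mul0r mulr0.
rewrite (E (fun s => w s * F s)) (E w) E0 mulr0 addr0.
rewrite [in RHS](eq_bigr (fun j => \sum_(s | agree S t s) w s * F s * (rate j s * diff j g s))).
  by rewrite mulrDl; ring.
by move=> j jS; rewrite dirichlet_form.
Qed.

(** Both means are within the diameter bound of [diff_path] from [g t]. This starts the iteration of
    the dynamics. *)
Lemma mean_gap_crude g (L : 'I_n -> R) :
  (forall i s, i \in S -> `|diff i g s| <= L i) ->
  `|mean_gap g| <= 2 * \sum_(i in S) L i.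
Proof.
move=> gL; have Z0 := subcube_mass_gt0; set K := \sum_(i in S) L i.
have -> : mean_gap g = (\sum_(s | agree S t s) w s * F s * (g s - g t)) / M
    - (\sum_(s | agree S t s) w s * (g s - g t)) / Z.
  have E G : \sum_(s | agree S t s) G s * (g s - g t) =
     \sum_(s | agree S t s) G s * g s - (\sum_(s | agree S t s) G s) * g t.
    by rewrite mulr_suml -sumrB; apply: eq_bigr => s _; ring.
  rewrite (E (fun s => w s * F s)) (E w) -/M -/Z /mean_gap.
  by field; rewrite !gt_eqF.
have B G : (forall s, 0 <= G s) -> 0 < \sum_(s | agree S t s) G s ->
   `|(\sum_(s | agree S t s) G s * (g s - g t)) / \sum_(s | agree S t s) G s| <= K.
  move=> G0 sG; rewrite normrM normfV (gtr0_norm sG) ler_pdivrMr//.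
  rewrite (le_trans (ler_norm_sum _ _ _))// mulr_sumr; apply: ler_sum => s st.
  by rewrite normrM ger0_norm// mulrC ler_wpM2r// (diff_path gL).
rewrite (le_trans (ler_normB _ _))// mulrDl mul1r lerD//.
  by apply: (B (fun s => w s * F s)) => // s; rewrite mulr_ge0// ltW.
by apply: B => // s; apply: ltW.
Qed.

End Tilt.
End Glauber.

(** * Logarithmic Sobolev inequality *)

Section Limits.
Local Open Scope classical_set_scope.

Lemma geometric_le {R : realType} (x a K rho : R) : 0 <= rho < 1 ->
  (forall k : nat, x <= a + K * rho ^+ k) -> x <= a.
Proof.
move=> /andP[r0 r1] xa.
have h : (fun k : nat => a + K * rho ^+ k) @ \oo --> a + K * 0.
  apply: cvgD; first exact: cvg_cst.
  apply: cvgM; [exact: cvg_cst|by apply: cvg_expr; rewrite ger0_norm].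
rewrite mulr0 addr0 in h.
rewrite -(cvg_lim (@Rhausdorff R) h); apply: limr_ge.
  by apply/cvg_ex; exists a.
by near=> k; exact: xa.
Unshelve. all: by end_near. Qed.

End Limits.

(** The left side is the unnormalised relative entropy of a two-point law. The inequality
    [ln x <= x - 1] bounds it by the chi-square distance, whose denominator is at least
    [beta ^+ 2]. *)
Lemma two_block_entropy {R : realType} (beta Ma Mb Za Zb : R) : 0 < beta ->
  0 <= Ma -> 0 <= Mb -> 0 < Ma + Mb -> 0 < Za -> 0 < Zb ->
  beta * (Za + Zb) <= Za -> beta * (Za + Zb) <= Zb ->
  Ma * ln (Ma / Za) + Mb * ln (Mb / Zb) - (Ma + Mb) * ln ((Ma + Mb) / (Za + Zb))
  <= (Ma + Mb) * (Ma / (Ma + Mb) - Za / (Za + Zb)) ^+ 2 / beta ^+ 2.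
Proof.
move=> b0 a0 c0 M0 za zb ba bb.
have Z0 : 0 < Za + Zb by rewrite addr_gt0.
set M := Ma + Mb; set Z := Za + Zb; rewrite -/M -/Z in M0 Z0 ba bb.
have E X z : 0 <= X -> 0 < z ->
    X * ln (X / z) <= X * ln (M / Z) + X * (X * Z / (M * z) - 1).
  rewrite le_eqVlt => /orP[/eqP <-|X0] z0; first by rewrite !mul0r addr0.
  rewrite -mulrDr ler_pM2l// -lerBlDl -ln_div ?posrE ?divr_gt0//.
  have -> : X / z / (M / Z) = 1 + (X * Z / (M * z) - 1).
    by field; rewrite !gt_eqF.
  by apply: le_ln1Dx; rewrite ltrBrDl subrr divr_gt0// mulr_gt0.
have Ea := E Ma Za a0 za; have Eb := E Mb Zb c0 zb.
apply: (@le_trans _ _ (Ma * (Ma * Z / (M * Za) - 1) + Mb * (Mb * Z / (M * Zb) - 1))).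
  have -> : M * ln (M / Z) = Ma * ln (M / Z) + Mb * ln (M / Z) by rewrite -mulrDl.
  by move: Ea Eb; lra.
(* The chi-square distance of two laws on two points, in closed form. *)
have -> : Ma * (Ma * Z / (M * Za) - 1) + Mb * (Mb * Z / (M * Zb) - 1) =
    M * (Ma / M - Za / Z) ^+ 2 / ((Za / Z) * (Zb / Z)).
  by rewrite /M /Z; field; rewrite -/M -/Z !gt_eqF.
apply: ler_wpM2l; first by rewrite mulr_ge0 ?sqr_ge0// ltW.
rewrite lef_pV2 ?posrE ?exprn_gt0 ?(mulr_gt0 (divr_gt0 za Z0) (divr_gt0 zb Z0))//.
by rewrite expr2 ler_pM ?(ltW b0)// ler_pdivlMr.
Qed.

Section LogSobolev.
Context {R : realType} {n : nat}.
Variable w : cube n -> R.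
Hypothesis w_gt0 : forall s, 0 < w s.
Context (A : 'I_n -> 'I_n -> R) (alpha beta : R).
Hypothesis alpha_gt0 : 0 < alpha.
Hypothesis alpha_le1 : alpha <= 1.
Hypothesis A_ge0 : forall i j, 0 <= A i j.
Hypothesis A_sym : forall i j, A i j = A j i.
Hypothesis A_row : forall i, \sum_j A i j <= 1 - alpha.
Hypothesis rate_lip : forall i j s, i != j ->
  `|rate w j (flip i s) - rate w j s| <= A i j.
Hypothesis beta_gt0 : 0 < beta.
Hypothesis rate_ge : forall i s, beta <= rate w i s.
Implicit Types (S : {set 'I_n}) (s t : cube n) (i j : 'I_n) (g : cube n -> R).

Section Gap.
Context (S : {set 'I_n}) (t : cube n) (F : cube n -> R).
Hypothesis F_ge0 : forall s, 0 <= F s.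
Hypothesis M_gt0 : 0 < \sum_(s | agree S t s) w s * F s.
Let M := \sum_(s | agree S t s) w s * F s.

(** Iterates [mean_gap_glauber]: each step shrinks the Euclidean norm [N] of the Lipschitz vector by
    [1 - alpha / #|S|] and costs at most [N * tau / #|S|] by Cauchy-Schwarz. The induction on [k]
    varies [g], as the next function is [glauber S g]. *)
Lemma mean_gap_geometric (tau : R) : (0 < #|S|)%N -> 0 <= tau ->
  \sum_(j in S) (tilt_flux w S t F j / M) ^+ 2 <= tau ^+ 2 ->
  forall k g (L : 'I_n -> R) N, (forall i, 0 <= L i) ->
  (forall i s, i \in S -> `|diff i g s| <= L i) ->
  0 <= N -> \sum_(i in S) L i ^+ 2 <= N ^+ 2 ->
  `|mean_gap w S t F g| <=
    N * (tau / alpha + (2 * #|S|%:R) * (1 - alpha / #|S|%:R) ^+ k).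
Proof.
move=> S0 tau0 Ttau; have S0' : 0 < #|S|%:R :> R by rewrite ltr0n.
have rho0 : 0 <= 1 - alpha / #|S|%:R.
  by rewrite subr_ge0 ler_pdivrMr// mul1r (le_trans alpha_le1)// ler1n.
elim=> [|k IH] g L N L0 gL N0 LN.
  rewrite (le_trans (mean_gap_crude w_gt0 F_ge0 M_gt0 gL))// expr0 mulr1.
  have LiN i : i \in S -> L i <= N.
    move=> iS; rewrite -(@ler_pXn2r _ 2)// ?nnegrE//.
    rewrite (le_trans _ LN)// (bigD1 i)//= lerDl sumr_ge0// => j _; exact: sqr_ge0.
  apply: (@le_trans _ _ (2 * (\sum_(i in S) N))).
    by rewrite ler_wpM2l// ler_sum.
  rewrite sumr_const -[N *+ _]mulr_natl mulrDr -[leLHS]add0r lerD//.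
    by rewrite mulr_ge0// divr_ge0// ltW.
  by rewrite mulrA [N * _]mulrC lexx.
rewrite (mean_gap_glauber w t F g S0) (le_trans (ler_normD _ _))//.
have gL' := glauber_lip w_gt0 A_ge0 rate_lip L0 gL.
have H := IH _ _ ((1 - alpha / #|S|%:R) * N) _ gL'.
(* [tau / alpha] is the fixed point of [x = (1 - alpha / #|S|) * x + tau / #|S|]. *)
rewrite (_ : N * _ = (1 - alpha / #|S|%:R) * N *
   (tau / alpha + 2 * #|S|%:R * (1 - alpha / #|S|%:R) ^+ k) + #|S|%:R^-1 * (N * tau)); last first.
  by rewrite exprS; field; rewrite !gt_eqF.
apply: lerD.
  apply: H.
  - move=> i; apply: sumr_ge0 => j _; rewrite mulr_ge0// mulr_ge0 ?invr_ge0//.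
    by rewrite addr_ge0// mulr_ge0.
  - by rewrite mulr_ge0.
  - rewrite exprMn (le_trans (glauber_contraction alpha_le1 A_ge0 A_sym A_row L S0))//.
    by rewrite ler_wpM2l ?sqr_ge0.
rewrite -mulrA normrM ger0_norm ?invr_ge0// ler_wpM2l ?invr_ge0//.
rewrite mulr_suml (le_trans (ler_norm_sum _ _ _))//.
apply: (@le_trans _ _ (\sum_(j in S) 1 * L j * (tilt_flux w S t F j / M))).
  apply: ler_sum => j jS; rewrite mul1r normrM normfV (gtr0_norm M_gt0) mulrA.
  rewrite ler_wpM2r ?invr_ge0 ?(ltW M_gt0)// /tilt_flux mulrCA normrM ger0_norm ?invr_ge0//.
  rewrite ler_wpM2l ?invr_ge0// (le_trans (ler_norm_sum _ _ _))// mulr_sumr.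
  have wr s : 0 <= w s * rate w j s by rewrite mulr_ge0 ?(ltW (w_gt0 s)) ?(rate_ge0 w_gt0).
  apply: ler_sum => s _; rewrite normrM (ger0_norm (wr s)) [leRHS]mulrC -[leRHS]mulrA.
  rewrite ler_wpM2l// normrM.
  by rewrite ler_wpM2l// gL.
apply: le_trans (ler_norm _) _.
rewrite -(@ler_pXn2r _ 2) ?nnegrE ?mulr_ge0// real_normK ?num_real//.
rewrite (le_trans (@cauchy_schwarz_sum _ _ (mem S) (fun=> 1) L _ (fun _ _ => ler01)))//.
under eq_bigr do rewrite mul1r; under [X in _ * X <= _]eq_bigr do rewrite mul1r.
by rewrite exprMn ler_pM// sumr_ge0// => j _; exact: sqr_ge0.
Qed.

Lemma mean_gap_le (tau : R) g (L : 'I_n -> R) N : (0 < #|S|)%N -> 0 <= tau ->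
  \sum_(j in S) (tilt_flux w S t F j / M) ^+ 2 <= tau ^+ 2 ->
  (forall i, 0 <= L i) ->
  (forall i s, i \in S -> `|diff i g s| <= L i) ->
  0 <= N -> \sum_(i in S) L i ^+ 2 <= N ^+ 2 ->
  `|mean_gap w S t F g| <= N * (tau / alpha).
Proof.
move=> S0 tau0 Ttau L0 gL N0 LN; have S0' : 0 < #|S|%:R :> R by rewrite ltr0n.
apply: (@geometric_le _ _ _ (N * (2 * #|S|%:R)) (1 - alpha / #|S|%:R)).
  rewrite subr_ge0 ler_pdivrMr// mul1r (le_trans alpha_le1) ?ler1n//=.
  by rewrite ltrBlDr ltrDl divr_gt0.
by move=> k; rewrite -mulrA -mulrDr; exact: (mean_gap_geometric S0 tau0 Ttau _ L0).
Qed.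

End Gap.

Let flux_le i s : w s * rate w i s <= w s.
Proof. by rewrite ler_piMr ?(rate_le1 w_gt0) ?ltW. Qed.

Let flux_ge0 i s : 0 <= w s * rate w i s.
Proof. by rewrite mulr_ge0 ?(rate_ge0 w_gt0) ?ltW. Qed.

(** Factor the difference of squares as [diff j u s] times [u s + u (flip j s)] and apply
    Cauchy-Schwarz. *)
Lemma tilt_flux_sqr S t (u : cube n -> R) j : j \in S ->
  tilt_flux w S t (fun s => u s ^+ 2) j ^+ 2 <=
  (\sum_(s | agree S t s) w s * u s ^+ 2) *
  (\sum_(s | agree S t s) w s * diff j u s ^+ 2).
Proof.
move=> jS; rewrite /tilt_flux exprMn.
rewrite (eq_bigr (fun s => w s * rate w j s * `|diff j u s| * `|u s + u (flip j s)|)); last first.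
  by move=> s _; rewrite -[RHS]mulrA -normrM /diff subr_sqr.
have := @cauchy_schwarz_sum _ _ (agree S t) (fun s => w s * rate w j s)
  (fun s => `|diff j u s|) (fun s => `|u s + u (flip j s)|) (fun s _ => flux_ge0 j s).
under [X in _ <= X * _ -> _]eq_bigr do rewrite real_normK ?num_real//.
under [X in _ <= _ * X -> _]eq_bigr do rewrite real_normK ?num_real//.
set X := (X in X ^+ 2 <= _) => H.
apply: le_trans (_ : 2^-1 ^+ 2 * ((\sum_(s | agree S t s) w s * diff j u s ^+ 2) *
   (4 * \sum_(s | agree S t s) w s * u s ^+ 2)) <= _); last first.
  by rewrite le_eqVlt; apply/orP; left; apply/eqP; field.
rewrite ler_wpM2l ?sqr_ge0// (le_trans H)//.
apply: ler_pM.
- by apply: sumr_ge0 => s _; rewrite mulr_ge0 ?sqr_ge0.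
- by apply: sumr_ge0 => s _; rewrite mulr_ge0 ?sqr_ge0.
- by apply: ler_sum => s _; rewrite ler_wpM2r ?sqr_ge0.
(* By detailed balance [c (flip j s)] carries the weight of [s] and the value of [u] at the flipped
   point, so both squares in [(x + y) ^+ 2 <= 2 * (x ^+ 2 + y ^+ 2)] have the same sum. *)
pose c s := w s * rate w j s * u s ^+ 2.
apply: (@le_trans _ _ (2 * (\sum_(s | agree S t s) c s + \sum_(s | agree S t s) c (flip j s)))).
  rewrite -big_split mulr_sumr /=; apply: ler_sum => s _.
  rewrite /c detailed_balance -mulrDr [leRHS]mulrCA ler_wpM2l// -subr_ge0.
  rewrite [leRHS](_ : _ = (u s - u (flip j s)) ^+ 2) ?sqr_ge0//; ring.
rewrite (sum_flip t c jS).
set Y := \sum_(s | _) c s; have -> : 2 * (Y + Y) = 4 * Y by ring.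
rewrite ler_wpM2l//.
by apply: ler_sum => s _; rewrite ler_wpM2r ?sqr_ge0.
Qed.

(** Duality: the gaps of the one-spin marginals are used as coefficients of the test function to
    which [mean_gap_le] is applied. *)
Lemma marginal_gap S t (u : cube n -> R) :
  let M := \sum_(s | agree S t s) w s * u s ^+ 2 in
  let Z := \sum_(s | agree S t s) w s in
  0 < M ->
  \sum_(i in S) ((\sum_(s | agree (S :\ i) t s) w s * u s ^+ 2) / M -
                 (\sum_(s | agree (S :\ i) t s) w s) / Z) ^+ 2 <=
  (\sum_(i in S) \sum_(s | agree S t s) w s * diff i u s ^+ 2) / M / alpha ^+ 2.
Proof.
move=> M Z M0.
set E := \sum_(i in S) \sum_(s | agree S t s) w s * diff i u s ^+ 2.
pose delta i := (\sum_(s | agree (S :\ i) t s) w s * u s ^+ 2) / M -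
                 (\sum_(s | agree (S :\ i) t s) w s) / Z.
rewrite -/(\sum_(i in S) delta i ^+ 2).
have E0 : 0 <= E.
  by apply: sumr_ge0 => i _; apply: sumr_ge0 => s _; rewrite mulr_ge0 ?sqr_ge0 ?ltW.
have [S0|] := posnP #|S|.
  rewrite big1 ?divr_ge0 ?sqr_ge0 ?(ltW M0)// => i.
  by rewrite (cards0_eq S0) inE.
move=> S0; set D := \sum_(i in S) delta i ^+ 2.
have D0 : 0 <= D by apply: sumr_ge0 => i _; exact: sqr_ge0.
(* With these coefficients the mean gap of [g] is exactly [D], while its Lipschitz vector has norm
   [Num.sqrt D]. Hence [D <= Num.sqrt D * (tau / alpha)]. *)
pose g (s : cube n) := \sum_(i in S) delta i * (s i == t i)%:R.
have gap : mean_gap w S t (fun s => u s ^+ 2) g = D.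
  rewrite /mean_gap /g -/M -/Z.
  have red (G : cube n -> R) : \sum_(s | agree S t s) G s * (\sum_(i in S) delta i * (s i == t i)%:R)
      = \sum_(i in S) delta i * \sum_(s | agree (S :\ i) t s) G s.
    under eq_bigr do rewrite mulr_sumr.
    rewrite exchange_big /=; apply: eq_bigr => i iS; rewrite mulr_sumr.
    rewrite [RHS](eq_bigl (fun s => agree S t s && (s i == t i))); last first.
      by move=> s; rewrite agreeD1.
    rewrite [RHS]big_mkcondr /=; apply: eq_bigr => s _.
    by case: eqP; rewrite ?mulr1 ?mulr0// mulrC.
  rewrite (red (fun s => w s * u s ^+ 2)) red !mulr_suml -sumrB; apply: eq_bigr => i _.
  by rewrite /delta; ring.
have gL i s : i \in S -> `|diff i g s| <= `|delta i|.
  move=> iS; rewrite /diff /g (bigD1 i)//= [X in _ - X](bigD1 i)//= flipE eqxx.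
  rewrite [X in _ - (_ + X)](eq_bigr (fun j => delta j * (s j == t j)%:R)); last first.
    by move=> j /andP[_ ji]; rewrite flipE (negbTE ji).
  rewrite opprD addrACA subrr addr0 -mulrBr normrM ler_piMr//.
  by case: (s i) (t i) => [] []; rewrite /= ?subr0 ?sub0r ?normrN normr1.
pose tau := Num.sqrt (E / M).
have EM0 : 0 <= E / M by rewrite divr_ge0// ltW.
have Ttau : \sum_(j in S) (tilt_flux w S t (fun s => u s ^+ 2) j / M) ^+ 2 <= tau ^+ 2.
  rewrite sqr_sqrtr// mulr_suml; apply: ler_sum => j jS.
  rewrite exprMn [leRHS](_ : _ = (M * (\sum_(s | agree S t s) w s * diff j u s ^+ 2)) * M^-1 ^+ 2).
    by rewrite ler_wpM2r ?sqr_ge0// tilt_flux_sqr.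
  by field; rewrite gt_eqF.
have := @mean_gap_le S t (fun s => u s ^+ 2) (fun s => sqr_ge0 _) M0 tau g
  (fun i => `|delta i|) (Num.sqrt D) S0 (sqrtr_ge0 _) Ttau (fun i => normr_ge0 _) gL (sqrtr_ge0 _).
rewrite sqr_sqrtr// gap ger0_norm// => H.
have {}H : D <= Num.sqrt D * (tau / alpha).
  by apply: H; rewrite le_eqVlt; apply/orP; left; apply/eqP; apply: eq_bigr => i _;
    rewrite real_normK ?num_real.
have [->|Dpos] := eqVneq D 0; first by rewrite divr_ge0 ?sqr_ge0.
have sD : 0 < Num.sqrt D by rewrite sqrtr_gt0 lt_def Dpos.
have : Num.sqrt D <= tau / alpha.
  by rewrite -(ler_pM2l sD) -expr2 sqr_sqrtr.
have ta0 : 0 <= tau / alpha by rewrite divr_ge0 ?sqrtr_ge0 ?ltW.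
rewrite -(@ler_pXn2r _ 2) ?nnegrE ?sqrtr_ge0//.
by rewrite expr_div_n !sqr_sqrtr.
Qed.

(** Not divided by the mass of the subcube, so that in [entropy_split] the entropies of the two
    halves simply add. *)
Definition entropy S t (u : cube n -> R) : R :=
  let M := \sum_(s | agree S t s) w s * u s ^+ 2 in
  \sum_(s | agree S t s) w s * u s ^+ 2 * ln (u s ^+ 2)
  - M * ln (M / \sum_(s | agree S t s) w s).

(** Pairing [s] with [flip i s], the value [t i] has conditional probability at least [beta] in each
    pair. *)
Lemma half_mass S t i : i \in S ->
  beta * (\sum_(s | agree S t s) w s) <= \sum_(s | agree (S :\ i) t s) w s.
Proof.
move=> iS; rewrite (sum_split _ _ iS) sum_flip_half// -big_split mulr_sumr /=.
apply: ler_sum => s _; have := rate_ge i (flip i s).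
by rewrite /rate flipK ler_pdivlMr ?addr_gt0// addrC.
Qed.

Lemma half_mass_flip S t i : i \in S ->
  beta * (\sum_(s | agree S t s) w s) <= \sum_(s | agree (S :\ i) (flip i t) s) w s.
Proof.
move=> iS; rewrite (_ : \sum_(s | agree S t s) w s = \sum_(s | agree S (flip i t) s) w s).
  exact: half_mass.
apply: eq_bigl => s; apply/agreeP/agreeP => st j jS; rewrite st// flipE; case: eqP => // ji;
  by move: jS; rewrite ji iS.
Qed.

(** Chain rule: the total exceeds the two conditional entropies by the entropy of the marginal of
    spin [i], which [two_block_entropy] bounds. *)
Lemma entropy_split S t (u : cube n -> R) i
    (M := \sum_(s | agree S t s) w s * u s ^+ 2) : i \in S ->
  entropy S t u <= entropy (S :\ i) t u + entropy (S :\ i) (flip i t) u +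
   M * ((\sum_(s | agree (S :\ i) t s) w s * u s ^+ 2) / M -
        (\sum_(s | agree (S :\ i) t s) w s) / (\sum_(s | agree S t s) w s)) ^+ 2 / beta ^+ 2.
Proof.
move=> iS; rewrite /entropy /M.
have [hm hmf] := (half_mass t iS, half_mass_flip t iS).
have za := subcube_mass_gt0 w_gt0 (S :\ i) t.
have zb := subcube_mass_gt0 w_gt0 (S :\ i) (flip i t).
have p0 S' t' : 0 <= \sum_(s | agree S' t' s) w s * u s ^+ 2.
  by apply: sumr_ge0 => s _; rewrite mulr_ge0 ?sqr_ge0 ?ltW.
have a0 := p0 (S :\ i) t; have b0 := p0 (S :\ i) (flip i t).
move: hm hmf; rewrite !(sum_split _ _ iS).
move: a0 b0 za zb.
move: (\sum_(s | _ t s) w s * u s ^+ 2) (\sum_(s | _ (flip i t) s) w s * u s ^+ 2) => Ma Mb.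
move: (\sum_(s | _ t s) w s) (\sum_(s | _ (flip i t) s) w s) => Za Zb.
move: (\sum_(s | _ t s) _) (\sum_(s | _ (flip i t) s) _) => X Y a0 b0 za zb hm hmf.
have [M0|] := ltP 0 (Ma + Mb).
  by have := two_block_entropy beta_gt0 a0 b0 M0 za zb hm hmf; lra.
move=> M0; have -> : Ma = 0 by move: a0 b0 M0; lra.
have -> : Mb = 0 by move: a0 b0 M0; lra.
by rewrite !(addr0, mul0r, subr0).
Qed.

(** Sum [entropy_split] over all [i] in [S]. The induction hypothesis omits each [E i] exactly once,
    and the marginal terms together pay for one full energy, so dividing by [#|S|] closes the
    induction with the same constant. *)
Lemma log_sobolev S t (u : cube n -> R) :
  entropy S t u <= (alpha * beta) ^- 2 *
    \sum_(i in S) \sum_(s | agree S t s) w s * diff i u s ^+ 2.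
Proof.
move Em : #|S| => m; elim: m S t Em => [|m IH] S t Em.
  rewrite (cards0_eq Em) /entropy big_set0 mulr0.
  rewrite !(big_pred1 t) ?agree_set0//; try by move=> s; rewrite agree_set0.
  have -> : w t * u t ^+ 2 / w t = u t ^+ 2 by field; rewrite gt_eqF.
  by rewrite subrr.
set C := _ ^- 2; pose E i := \sum_(s | agree S t s) w s * diff i u s ^+ 2.
rewrite -/(\sum_(i in S) E i).
have C0 : 0 <= C by rewrite invr_ge0 sqr_ge0.
set M := \sum_(s | agree S t s) w s * u s ^+ 2.
set Z := \sum_(s | agree S t s) w s.
pose delta i := (\sum_(s | agree (S :\ i) t s) w s * u s ^+ 2) / M -
                 (\sum_(s | agree (S :\ i) t s) w s) / Z.
have step i : i \in S -> entropy S t u <= C * (\sum_(j in S) E j - E i) + M * delta i ^+ 2 / beta ^+ 2.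
  move=> iS; apply: le_trans (entropy_split t u iS) _; rewrite lerD2r.
  have cS : #|S :\ i| = m by move: Em; rewrite (cardsD1 i) iS => -[].
  apply: le_trans (lerD (IH _ t cS) (IH _ (flip i t) cS)) _.
  rewrite -mulrDr ler_wpM2l// -big_split [in leRHS](big_setD1 i)//= addrAC subrr add0r.
  by apply: ler_sum => j _; rewrite /E (sum_split _ _ iS).
have : \sum_(i in S) entropy S t u <= \sum_(i in S) (C * (\sum_(j in S) E j - E i) + M * delta i ^+ 2 / beta ^+ 2).
  exact: ler_sum.
rewrite sumr_const Em big_split /= -!mulr_sumr -mulr_suml sumrB sumr_const Em -mulr_sumr.
(* This fixes the constant: [alpha ^- 2] comes from [marginal_gap] and [beta ^- 2] from
   [two_block_entropy]. *)
have : M * (\sum_(i in S) delta i ^+ 2) / beta ^+ 2 <= C * \sum_(j in S) E j.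
  have M0 : 0 <= M by apply: sumr_ge0 => s _; rewrite mulr_ge0 ?sqr_ge0 ?ltW.
  have [->|Mn] := eqVneq M 0.
    rewrite !mul0r mulr_ge0//; apply: sumr_ge0 => i _; apply: sumr_ge0 => s _.
    by rewrite mulr_ge0 ?sqr_ge0 ?ltW.
  have {}M0 : 0 < M by rewrite lt_def Mn.
  have := @marginal_gap S t u M0; rewrite -/M -/Z => H.
  rewrite ler_pdivrMr ?exprn_gt0// -ler_pdivlMl//; apply: le_trans H _.
  rewrite le_eqVlt; apply/orP; left; apply/eqP; rewrite /C /E.
  by field; rewrite !gt_eqF.
move: (\sum_(i in S) E i) => EE h1 h2.
rewrite -(ler_pMn2r (ltn0Sn m)); apply: le_trans h2 _.
apply: le_trans (lerD (lexx _) h1) _.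
by rewrite mulrSr; lra.
Qed.

End LogSobolev.

(** * Moment growth *)

Section PowerInequalities.
Context {R : realType}.
Implicit Types (a b x y : R).

(** For [b <= a] the difference of powers is [a - b] times [m.+1] terms, each at most [a ^+ m].
    Keeping both powers on the right makes the bound symmetric. *)
Lemma ler_pow_diff a b m : 0 <= a -> 0 <= b ->
  (a ^+ m.+1 - b ^+ m.+1) ^+ 2 <=
  m.+1%:R ^+ 2 * (a - b) ^+ 2 * ((a ^+ 2) ^+ m + (b ^+ 2) ^+ m).
Proof.
wlog ba : a b / b <= a.
  move=> H a0 b0; have [ba|/ltW ab] := leP b a; first exact: H.
  by rewrite -(sqrrN (a ^+ _ - _)) -(sqrrN (a - b)) !opprB [X in _ * X]addrC H.
move=> a0 b0.
apply: (@le_trans _ _ ((m.+1%:R * (a - b) * a ^+ m) ^+ 2)); last first.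
  rewrite [X in X <= _](_ : _ = m.+1%:R ^+ 2 * (a - b) ^+ 2 * (a ^+ 2) ^+ m); last first.
    by rewrite exprMn [(_ * (a - b)) ^+ 2]exprMn (exprAC a).
  apply: ler_wpM2l; first by rewrite mulr_ge0 ?sqr_ge0.
  by rewrite lerDl exprn_ge0// sqr_ge0.
have d0 : 0 <= a ^+ m.+1 - b ^+ m.+1 by rewrite subr_ge0 lerXn2r ?nnegrE.
rewrite ler_pXn2r ?nnegrE//; last by rewrite !mulr_ge0 ?exprn_ge0 ?subr_ge0.
rewrite subrXX [m.+1%:R * _]mulrC -mulrA ler_wpM2l ?subr_ge0//.
apply: (@le_trans _ _ (\sum_(i < m.+1) a ^+ m)).
  apply: ler_sum => i _; rewrite /= -[X in _ <= a ^+ X](@subnK i m) ?exprD; last by rewrite -ltnS.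
  by rewrite ler_wpM2l ?exprn_ge0// lerXn2r ?nnegrE.
by rewrite sumr_const card_ord -[_ *+ _]mulr_natl.
Qed.

(** Young's inequality for integer exponents. The induction multiplies by [a] and uses that
    [a ^+ m.+1 - b ^+ m.+1] and [a - b] have the same sign. *)
Lemma young_pow m a b : 0 <= a -> 0 <= b ->
  m.+1%:R * (a ^+ m * b) <= m%:R * a ^+ m.+1 + b ^+ m.+1.
Proof.
move=> a0 b0; elim: m => [|m IH]; first by rewrite !expr0 !mul1r mul0r add0r !expr1.
have H : a ^+ m.+1 * b + a * b ^+ m.+1 <= a ^+ m.+2 + b ^+ m.+2.
  rewrite -subr_ge0 (_ : _ - _ = (a ^+ m.+1 - b ^+ m.+1) * (a - b)); last first.
    by rewrite !exprS; ring.
  have [ab|/ltW ba] := leP a b.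
    by rewrite mulr_le0// subr_le0// lerXn2r ?nnegrE.
  by rewrite mulr_ge0// subr_ge0// lerXn2r ?nnegrE.
have := ler_wpM2l a0 IH.
rewrite -(natr1 m.+1) -(natr1 m); move: H; rewrite !exprS; move: (m%:R) (a ^+ m) (b ^+ m) => M A B.
by lra.
Qed.

Lemma exists_root m y : 0 <= y -> exists2 x : R, 0 <= x & x ^+ m.+1 = y.
Proof.
move=> y0; exists (y `^ m.+1%:R^-1); first exact: powR_ge0.
by rewrite -powR_mulrn ?powR_ge0// -powRrM mulVf ?powRr1// pnatr_eq0.
Qed.

End PowerInequalities.

(** * Expectations and Jensen's inequality *)

Section Mean.
Context {R : realType} {n : nat}.
Variable w : cube n -> R.
Hypothesis w_gt0 : forall s, 0 < w s.
Implicit Types (f g : cube n -> R).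

Definition mean g : R := (\sum_s w s * g s) / \sum_s w s.

Lemma mass_gt0 : 0 < \sum_s w s.
Proof.
rewrite (bigD1 [ffun=> true])//= ltr_wpDr//.
by apply: sumr_ge0 => s _; apply: ltW.
Qed.

Lemma eq_mean f g : f =1 g -> mean f = mean g.
Proof. by move=> fg; congr (_ / _); apply: eq_bigr => s _; rewrite fg. Qed.

Lemma ler_mean f g : (forall s, f s <= g s) -> mean f <= mean g.
Proof.
move=> fg; rewrite ler_wpM2r ?invr_ge0 ?(ltW mass_gt0)//.
by apply: ler_sum => s _; rewrite ler_wpM2l// ltW.
Qed.

Lemma mean_cst c : mean (fun=> c) = c.
Proof. by rewrite /mean -mulr_suml mulrAC divff ?mul1r// gt_eqF// mass_gt0. Qed.

Lemma meanD f g : mean (fun s => f s + g s) = mean f + mean g.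
Proof. by rewrite /mean -mulrDl -big_split; congr (_ / _); apply: eq_bigr => s _; rewrite mulrDr. Qed.

Lemma meanZ c g : mean (fun s => c * g s) = c * mean g.
Proof. by rewrite /mean mulrA mulr_sumr; congr (_ / _); apply: eq_bigr => s _; rewrite mulrCA. Qed.

Lemma mean_sum {I : finType} (G : I -> cube n -> R) :
  mean (fun s => \sum_i G i s) = \sum_i mean (G i).
Proof.
rewrite /mean -mulr_suml exchange_big; congr (_ / _); apply: eq_bigr => s _.
by rewrite mulr_sumr.
Qed.

Lemma mean_ge0 g : (forall s, 0 <= g s) -> 0 <= mean g.
Proof. by move=> g0; rewrite -(mean_cst 0) ler_mean. Qed.

Lemma mean_eq0 g s : (forall s, 0 <= g s) -> mean g = 0 -> g s = 0.
Proof.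
move=> g0 /eqP; rewrite mulf_eq0 invr_eq0 (gt_eqF mass_gt0) orbF psumr_eq0.
  by move=> /allP/(_ s (mem_index_enum _)); rewrite /= mulf_eq0 gt_eqF// => /eqP.
by move=> s' _; rewrite mulr_ge0// ltW.
Qed.

(* Jensen's inequality for [ln] under the density proportional to [u ^ 2]. *)
Lemma mean_sqr_ge u (m := mean (fun s => u s ^+ 2)) : (forall s, 0 <= u s) -> 0 < m ->
  m * expR (ln m - mean (fun s => u s ^+ 2 * ln (u s ^+ 2)) / m) <= mean u ^+ 2.
Proof.
move=> u0 m0; set v := mean u; set L := mean (fun s => _ * ln _).
have v0 : 0 < v.
  rewrite lt_def mean_ge0// andbT; apply/eqP => v0.
  suff : m = 0 by move=> mE; rewrite mE ltxx in m0.
  by rewrite /m -(mean_cst 0); apply: eq_mean => s; rewrite (mean_eq0 s u0 v0) expr0n.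
have vm : 0 < v / m by rewrite divr_gt0.
have key : - L <= 2 * (m * ln (v / m)).
  have -> : - L = mean (fun s => - (u s ^+ 2 * ln (u s ^+ 2))).
    by rewrite -[LHS]mulN1r -meanZ; apply: eq_mean => s; rewrite mulN1r.
  (* Pointwise this is [ln x <= x - 1] at [x = m / (v * u s)]. After averaging, the contributions
     [2 * m] and [- (2 * m)] cancel. *)
  apply: (@le_trans _ _ (mean (fun s => 2 * (m / v * u s) + 2 * (ln (v / m) - 1) * u s ^+ 2))).
    apply: ler_mean => s; have := u0 s; rewrite le_eqVlt => /orP[/eqP <-|us].
      by rewrite expr0n /= mul0r !mulr0 addr0 oppr0.
    have -> : 2 * (m / v * u s) + 2 * (ln (v / m) - 1) * u s ^+ 2 =
       u s ^+ 2 * (2 * (m / (v * u s) + ln (v / m) - 1)).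
      by field; rewrite !gt_eqF.
    rewrite -mulrN ler_pM2l ?exprn_gt0// lnXn// -[ln (u s) *+ 2]mulr_natl -mulrN ler_pM2l//.
    rewrite -subr_ge0.
    have := @le_ln1Dx R (m / (v * u s) - 1).
    have vu : 0 < v * u s by apply: mulr_gt0.
    have mvu : 0 < m / (v * u s) by apply: divr_gt0.
    rewrite ltrBrDl subrr mvu => /(_ isT).
    have -> : 1 + (m / (v * u s) - 1) = ((v / m) * u s)^-1.
      by field; rewrite !gt_eqF.
    by rewrite lnV ?posrE ?(mulr_gt0 vm us)// lnM ?posrE//; lra.
  rewrite meanD (eq_mean (g := fun s => 2 * (m / v) * u s)); last by move=> s; rewrite mulrA.
  rewrite !meanZ -/v -/m le_eqVlt; apply/orP; left; apply/eqP.
  by field; rewrite gt_eqF.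
have -> : v ^+ 2 = expR (2 * ln v).
  by rewrite mulr_natl -lnXn// lnK// posrE exprn_gt0.
rewrite -{1}(lnK (x := m)) ?posrE// -expRD ler_expR.
move: key; rewrite ln_div ?posrE// => key.
have : - L / m <= 2 * (ln v - ln m).
  by rewrite ler_pdivrMr// mulrC; move: key; lra.
by rewrite mulNr; lra.
Qed.

End Mean.

(** * Poincaré inequality and doubling of moments from the logarithmic Sobolev inequality *)

Section Moments.
Context {R : realType} {n : nat}.
Variable w : cube n -> R.
Hypothesis w_gt0 : forall s, 0 < w s.
Notation E := (mean w).
Definition energy (u : cube n -> R) s : R := \sum_i diff i u s ^+ 2.
Context (C beta : R).
Hypothesis C_gt0 : 0 < C.
Hypothesis beta_gt0 : 0 < beta.
Hypothesis rate_ge : forall i s, beta <= rate w i s.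
Hypothesis lsi : forall t u, entropy w setT t u <=
  C * \sum_(i in setT) \sum_(s | agree setT t s) w s * diff i u s ^+ 2.
Implicit Types (u f g : cube n -> R).

Lemma lsi_mean u (m := E (fun s => u s ^+ 2)) : 0 < m ->
  E (fun s => u s ^+ 2 * ln (u s ^+ 2)) - m * ln m <= C * E (energy u).
Proof.
move=> m0; have Z0 := mass_gt0 w_gt0.
have := lsi [ffun=> true] u; rewrite /entropy.
have aT (G : cube n -> R) : \sum_(s | agree setT [ffun=> true] s) G s = \sum_s G s.
  by apply: eq_bigl => s; rewrite agree_setT.
rewrite !aT; under [X in _ <= _ * X -> _]eq_bigr do rewrite aT.
rewrite -/(E (fun s => u s ^+ 2)) -/m.
have -> : \sum_s w s * u s ^+ 2 = m * \sum_s w s by rewrite /m /mean divfK// gt_eqF.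
move=> H; rewrite -(ler_pM2r Z0) mulrBl.
have -> : E (fun s => u s ^+ 2 * ln (u s ^+ 2)) * \sum_s w s = \sum_s w s * u s ^+ 2 * ln (u s ^+ 2).
  by rewrite /mean divfK ?gt_eqF//; apply: eq_bigr => s _; rewrite mulrA.
rewrite mulrAC; apply: le_trans H _; rewrite -mulrA ler_wpM2l ?(ltW C_gt0)//.
rewrite /mean divfK ?gt_eqF// exchange_big /=; apply: ler_sum => s _.
by rewrite /energy mulr_sumr le_eqVlt; apply/orP; left; apply/eqP; apply: eq_bigl => i; rewrite inE.
Qed.

(** Lower bound for the first moment by the second, with the energy in the exponent; it yields both
    [poincare] and [moment_step]. *)
Lemma mean_sqr_lsi u (m := E (fun s => u s ^+ 2)) : (forall s, 0 <= u s) -> 0 < m ->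
  m * expR (- (C * E (energy u) / m)) <= E u ^+ 2.
Proof.
move=> u0 m0; apply: le_trans (mean_sqr_ge w_gt0 u0 m0); rewrite -/m ler_pM2l// ler_expR.
have H := lsi_mean m0; rewrite -/m in H.
have mV : 0 <= m^-1 by rewrite invr_ge0 ltW.
have := ler_wpM2r mV H; rewrite mulrBl [m * ln m]mulrC mulfK ?gt_eqF//; lra.
Qed.

(** Linearise the exponential in [mean_sqr_lsi] by [1 + x <= expR x]. *)
Lemma poincare f : E (fun s => (f s - E f) ^+ 2) <= C * E (energy f).
Proof.
have eng0 s : 0 <= energy f s by apply: sumr_ge0 => i _; exact: sqr_ge0.
(* Adding a constant makes [f] nonnegative without changing its energy. *)
pose c := \sum_s `|f s|; pose u s := f s + c.
have u0 s : 0 <= u s.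
  rewrite /u /c (bigD1 s)//= addrA addr_ge0 ?sumr_ge0//.
  by have := ler_norm (- f s); rewrite normrN; lra.
have eu : energy u =1 energy f.
  by move=> s; apply: eq_bigr => i _; rewrite /diff /u; congr (_ ^+ 2); ring.
have -> : E (fun s => (f s - E f) ^+ 2) = E (fun s => u s ^+ 2) - E u ^+ 2.
  have Eu : E u = E f + c by rewrite /u meanD mean_cst.
  transitivity (E (fun s => u s ^+ 2 + ((- (2 * E u)) * u s + E u ^+ 2))).
    by apply: eq_mean => s; rewrite Eu /u; ring.
  rewrite (meanD w (fun s => u s ^+ 2) (fun s => - (2 * E u) * u s + E u ^+ 2)).
  rewrite (meanD w (fun s => - (2 * E u) * u s) (fun=> E u ^+ 2)) meanZ mean_cst//.
  by rewrite -/(E u); ring.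
have [m0|] := ltP 0 (E (fun s => u s ^+ 2)); last first.
  move=> m0; apply: (@le_trans _ _ 0); last by rewrite mulr_ge0 ?(ltW C_gt0)// mean_ge0.
  by have := sqr_ge0 (E u); lra.
have := mean_sqr_lsi u0 m0; rewrite (eq_mean _ eu).
set m := E _ in m0 *; set e := C * _ => H.
have := expR_ge1Dx (- (e / m)); rewrite -(ler_pM2l m0) mulrDr mulr1 mulrN.
have -> : m * (e / m) = e by rewrite mulrC divfK// gt_eqF.
by lra.
Qed.

Lemma mean_flip i (G : cube n -> R) : (forall s, 0 <= G s) ->
  E (fun s => G (flip i s)) <= beta^-1 * E G.
Proof.
move=> G0; rewrite -meanZ /mean ler_wpM2r ?invr_ge0 ?(ltW (mass_gt0 w_gt0))//.
rewrite [leRHS](reindex_inj (inv_inj (flipK i))) /=; apply: ler_sum => s _.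
rewrite mulrA ler_wpM2r// ler_pdivlMr// mulrC.
have := rate_ge i s; rewrite /rate ler_pdivlMr ?addr_gt0//; apply: le_trans.
by rewrite ler_wpM2l ?(ltW beta_gt0)// lerDl ltW.
Qed.

(** A discrete chain rule. [ler_pow_diff] also involves the value at the flipped point; [mean_flip]
    brings it back to [s] at the price [beta^-1]. *)
Lemma energy_pow g m :
  E (energy (fun s => `|g s| ^+ m.+1)) <=
  m.+1%:R ^+ 2 * (1 + beta^-1) * E (fun s => (g s ^+ 2) ^+ m * energy g s).
Proof.
have G0 s : 0 <= (g s ^+ 2) ^+ m by rewrite exprn_ge0 ?sqr_ge0.
pose a i s := diff i g s ^+ 2 * (g s ^+ 2) ^+ m.
have a0 i s : 0 <= a i s by rewrite mulr_ge0 ?sqr_ge0.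
apply: (@le_trans _ _ (E (fun s => \sum_i (m.+1%:R ^+ 2 * (a i s + a i (flip i s)))))).
  apply: (ler_mean w_gt0) => s; apply: ler_sum => i _.
  apply: le_trans (ler_pow_diff _ _ _) _ => //.
  rewrite !real_normK ?num_real// -mulrA ler_wpM2l ?sqr_ge0//.
  have -> : a i s + a i (flip i s) =
    diff i g s ^+ 2 * ((g s ^+ 2) ^+ m + (g (flip i s) ^+ 2) ^+ m).
    by rewrite /a /diff flipK; ring.
  rewrite ler_wpM2r ?addr_ge0//.
  rewrite -[leRHS]real_normK ?num_real// -[leLHS]real_normK ?num_real//.
  by rewrite lerXn2r ?nnegrE// ler_dist_dist.
rewrite mean_sum.
apply: (@le_trans _ _ (\sum_i m.+1%:R ^+ 2 * (1 + beta^-1) * E (a i))).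
  apply: ler_sum => i _; rewrite meanZ meanD -mulrA ler_wpM2l ?sqr_ge0//.
  by rewrite mulrDl mul1r lerD2l mean_flip.
rewrite -mulr_sumr -mean_sum le_eqVlt; apply/orP; left; apply/eqP; congr (_ * _).
by apply: eq_mean => s; rewrite /a -mulr_suml mulrC.
Qed.

(** Collects the factor 2 of [energy g s <= 2 * Gam s], the constant [C] of the logarithmic Sobolev
    inequality and the price [1 + beta^-1] of [energy_pow]. *)
Definition kappa : R := 2 * C * (1 + beta^-1).

Lemma kappa_gt0 : 0 < kappa.
Proof.
apply: mulr_gt0; first by rewrite mulr_gt0.
by rewrite addr_gt0// invr_gt0.
Qed.

(** With [p = m.+1], [mean_sqr_lsi] for [|g|^p] compares [X], the square of the [L^(2p)] norm of
    [g], with the bound [Y] on the square of its [L^p] norm. Taking [p]-th roots leaves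
    [X * expR (- (z / X)) <= Y] with [z = kappa * p * H], hence [X - z <= Y]. *)
Lemma moment_step g (Gam : cube n -> R) (Y H : R) m :
  (forall s, energy g s <= 2 * Gam s) -> 0 <= Y -> 0 < H ->
  E (fun s => `|g s| ^+ m.+1) ^+ 2 <= Y ^+ m.+1 ->
  E (fun s => Gam s ^+ m.+1) <= H ^+ m.+1 ->
  E (fun s => (g s ^+ 2) ^+ m.+1) <= (Y + kappa * m.+1%:R * H) ^+ m.+1.
Proof.
move=> gGam Y0 H0 EY EH.
have e0 s : 0 <= energy g s by apply: sumr_ge0 => i _; exact: sqr_ge0.
have Gam0 s : 0 <= Gam s by have := gGam s; have := e0 s; lra.
have k0 := kappa_gt0.
have kq0 : 0 < kappa * m.+1%:R * H by rewrite (mulr_gt0 _ H0)// (mulr_gt0 k0).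
have G0 s : 0 <= (g s ^+ 2) ^+ m.+1 by rewrite exprn_ge0 ?sqr_ge0.
have [X X0 XE] := exists_root m (mean_ge0 w_gt0 G0).
rewrite -XE lerXn2r ?nnegrE ?addr_ge0 ?(ltW kq0)//.
move: X0; rewrite le_eqVlt => /orP[/eqP <-|X0]; first by rewrite addr_ge0 ?(ltW kq0).
(* Hölder with exponents [p / (p - 1)] and [p]: Young's inequality after rescaling by [X] and
   [H]. *)
have holder : E (fun s => (g s ^+ 2) ^+ m * Gam s) <= X ^+ m * H.
  have XV : X^-1 ^+ m.+1 * X ^+ m.+1 = 1 by rewrite -exprMn mulVf ?expr1n// gt_eqF.
  have HV : H^-1 ^+ m.+1 * H ^+ m.+1 = 1 by rewrite -exprMn mulVf ?expr1n// gt_eqF.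
  have : E (fun s => (X^-1 * g s ^+ 2) ^+ m * (H^-1 * Gam s)) <= 1.
    rewrite -(ler_pM2l (x := m.+1%:R)) ?ltr0n// mulr1 -meanZ.
    apply: (@le_trans _ _ (E (fun s => m%:R * X^-1 ^+ m.+1 * (g s ^+ 2) ^+ m.+1 + H^-1 ^+ m.+1 * Gam s ^+ m.+1))).
      apply: (ler_mean w_gt0) => s.
      have gX : 0 <= X^-1 * g s ^+ 2.
        by apply: mulr_ge0; [rewrite invr_ge0 ltW|exact: sqr_ge0].
      have GH : 0 <= H^-1 * Gam s by rewrite mulr_ge0// invr_ge0 ltW.
      have := young_pow m gX GH.
      by rewrite [(X^-1 * _) ^+ m.+1]exprMn [(H^-1 * _) ^+ m.+1]exprMn [X in _ <= X + _ -> _]mulrA.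
    rewrite meanD !meanZ -XE -mulrA XV mulr1 -natr1 lerD2l -HV.
    by rewrite ler_wpM2l// exprn_ge0// invr_ge0 ltW.
  have -> : E (fun s => (X^-1 * g s ^+ 2) ^+ m * (H^-1 * Gam s)) =
      (X ^+ m * H)^-1 * E (fun s => (g s ^+ 2) ^+ m * Gam s).
    by rewrite -meanZ; apply: eq_mean => s; rewrite exprMn exprVn invfM mulrACA.
  by rewrite ler_pdivrMl ?mulr1// mulr_gt0// exprn_gt0.
have u0 s : 0 <= `|g s| ^+ m.+1 by rewrite exprn_ge0.
have Eu2 : E (fun s => (`|g s| ^+ m.+1) ^+ 2) = X ^+ m.+1.
  by rewrite XE; apply: eq_mean => s; rewrite exprAC real_normK ?num_real.
have := mean_sqr_lsi u0; rewrite Eu2 => /(_ (exprn_gt0 _ X0)) => /le_trans/(_ EY) key.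
have {}key : X ^+ m.+1 * expR (- (kappa * m.+1%:R ^+ 2 * (X ^+ m * H) / X ^+ m.+1)) <= Y ^+ m.+1.
  apply: le_trans key; rewrite ler_pM2l ?exprn_gt0// ler_expR lerN2.
  rewrite ler_wpM2r ?invr_ge0 ?exprn_ge0 ?(ltW X0)//.
  apply: le_trans (ler_wpM2l (ltW C_gt0) (energy_pow g m)) _.
  have -> : kappa * m.+1%:R ^+ 2 * (X ^+ m * H) =
     C * (m.+1%:R ^+ 2 * (1 + beta^-1) * (2 * (X ^+ m * H))) by rewrite /kappa; ring.
  rewrite ler_pM2l// ler_wpM2l ?mulr_ge0 ?addr_ge0 ?invr_ge0 ?(ltW beta_gt0) ?sqr_ge0//.
  apply: le_trans (_ : _ <= E (fun s => 2 * ((g s ^+ 2) ^+ m * Gam s))) _.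
    apply: (ler_mean w_gt0) => s; rewrite [leRHS]mulrCA.
    by apply: ler_wpM2l (gGam s); rewrite exprn_ge0// sqr_ge0.
  by rewrite meanZ ler_wpM2l.
have E1 : kappa * m.+1%:R ^+ 2 * (X ^+ m * H) / X ^+ m.+1 = m.+1%:R * (kappa * m.+1%:R * H / X).
  have Xm : X ^+ m != 0 by rewrite gt_eqF// exprn_gt0.
  rewrite (exprSr X); move: (X ^+ m) kappa Xm => Xm k Xm0.
  by field; rewrite Xm0 gt_eqF.
move: key; rewrite E1 -mulrN expRM_natl -exprMn ler_pXn2r ?nnegrE ?mulr_ge0 ?expR_ge0 ?(ltW X0)//.
move: (kappa * _ * H) kq0 => z z0 key.
have h := ler_wpM2l (ltW X0) (expR_ge1Dx (- (z / X))).
move: h; rewrite mulrDr mulr1 mulrN.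
have -> : X * (z / X) = z by rewrite mulrC divfK// gt_eqF.
by lra.
Qed.

(** Iterates [moment_step] along [p = 2 ^ k]. Since [H] is nondecreasing, the accumulated increments
    form a geometric sum dominated by twice its last term, whence [2 * kappa]. *)
Lemma dyadic_moments g (Gam : cube n -> R) (Y : R) (H : nat -> R) :
  (forall s, energy g s <= 2 * Gam s) -> 0 <= Y ->
  (forall k, 0 < H k) -> {homo H : k l / (k <= l)%N >-> k <= l} ->
  E (fun s => g s ^+ 2) <= Y ->
  (forall k, E (fun s => Gam s ^+ (2 ^ k)) <= H k ^+ (2 ^ k)) ->
  forall k, E (fun s => (g s ^+ 2) ^+ (2 ^ k)) <=
    (Y + 2 * kappa * (2 ^ k)%:R * H k) ^+ (2 ^ k).
Proof.
move=> gGam Y0 H0 Hmono EY EH.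
have k0 := kappa_gt0.
have c0 (l : nat) : 0 <= 2 * kappa * l%:R.
  by apply: mulr_ge0 => //; apply: mulr_ge0 => //; exact: ltW.
have cH (l k : nat) : 0 <= 2 * kappa * l%:R * H k by apply: mulr_ge0 => //; exact: ltW.
elim=> [|k IH].
  rewrite expn0 !expr1; apply: le_trans EY _.
  by rewrite lerDl.
have [m mE] : exists m, (2 ^ k.+1)%N = m.+1 by exists (2 ^ k.+1).-1; rewrite prednK ?expn_gt0.
have Y'0 : 0 <= Y + 2 * kappa * (2 ^ k)%:R * H k.
  by rewrite addr_ge0.
have := @moment_step g Gam (Y + 2 * kappa * (2 ^ k)%:R * H k) (H k.+1) m gGam Y'0 (H0 _).
rewrite -mE => /(_ _ (EH _)) step; apply: le_trans (step _) _.
  rewrite expnS mulnC exprM -(exprM _ _ 2) [in leRHS]exprM lerXn2r ?nnegrE ?exprn_ge0//.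
    by apply: (mean_ge0 w_gt0) => s; rewrite exprn_ge0.
  apply: le_trans IH; rewrite le_eqVlt; apply/orP; left; apply/eqP; apply: eq_mean => s.
  by rewrite mulnC exprM real_normK ?num_real.
have kH : 0 <= kappa * (2 ^ k.+1)%:R * H k.+1.
  by apply: mulr_ge0 (ltW (H0 _)); apply: mulr_ge0 => //; exact: ltW.
rewrite lerXn2r ?nnegrE ?addr_ge0//.
rewrite expnS natrM -addrA lerD2l.
have h1 : 2 * kappa * (2 ^ k)%:R * H k <= 2 * kappa * (2 ^ k)%:R * H k.+1.
  by apply: ler_wpM2l => //; exact: Hmono.
by move: h1; lra.
Qed.

End Moments.

(** * Tensors of iterated differences and their gradients *)

Section IteratedDifferences.
Context {R : realType} {n : nat}.
Implicit Types (f : cube n -> R) (s : cube n).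

Lemma hdiff_sqr i f s : hdiff i f s ^+ 2 = diff i f s ^+ 2 / 2.
Proof. by rewrite /hdiff exprMn real_normK ?num_real// exprVn sqr_sqrtr. Qed.

Lemma hnorm_ge0 k f s : 0 <= hnorm k f s.
Proof. exact: sqrtr_ge0. Qed.

Lemma hnorm_sqr k f s :
  hnorm k f s ^+ 2 = \sum_(t : k.-tuple 'I_n) hiter t f s ^+ 2.
Proof. by rewrite /hnorm sqr_sqrtr// sumr_ge0// => t _; exact: sqr_ge0. Qed.

(** The head of a tuple of indices is the outermost difference; the factor 2 undoes its
    normalisation by [Num.sqrt 2]. *)
Lemma hnormS_sqr k f s :
  2 * hnorm k.+1 f s ^+ 2 = \sum_(t : k.-tuple 'I_n) energy (hiter t f) s.
Proof.
rewrite hnorm_sqr exchange_big /= pair_big /= mulr_sumr.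
pose h (p : 'I_n * k.-tuple 'I_n) : k.+1.-tuple 'I_n := cons_tuple p.1 p.2.
rewrite (reindex h) /=.
  by apply: eq_bigr => p _; rewrite hdiff_sqr; field.
exists (fun t => (thead t, behead_tuple t)) => [[i t] _|t _].
  by rewrite /h /= theadE; congr (_, _); exact: val_inj.
by rewrite /h /= [RHS]tuple_eta; exact: val_inj.
Qed.

Lemma energy_hnorm1 f s : energy f s = 2 * hnorm 1 f s ^+ 2.
Proof.
rewrite hnormS_sqr (big_pred1 [tuple])// => t; symmetry.
by apply/eqP; rewrite (tuple0 t).
Qed.

(* The reverse triangle inequality for the Euclidean norm of the tensor of
   [k]-th order differences. *)
Lemma energy_hnorm k f s : energy (hnorm k f) s <= 2 * hnorm k.+1 f s ^+ 2.
Proof.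
rewrite hnormS_sqr exchange_big /=; apply: ler_sum => i _.
pose a (t : k.-tuple 'I_n) := hiter t f s.
pose b (t : k.-tuple 'I_n) := hiter t f (flip i s).
have -> : \sum_(t : k.-tuple 'I_n) diff i (hiter t f) s ^+ 2 =
    hnorm k f s ^+ 2 + hnorm k f (flip i s) ^+ 2 - 2 * \sum_t a t * b t.
  rewrite !hnorm_sqr mulr_sumr -big_split -sumrB; apply: eq_bigr => t _.
  by rewrite /a /b /diff /=; ring.
(* Once the squares are expanded, only Cauchy-Schwarz for the cross term is left. *)
suff : \sum_t a t * b t <= hnorm k f s * hnorm k f (flip i s).
  by rewrite /diff sqrrB => h; move: h; rewrite mulr2n; lra.
apply: le_trans (ler_norm _) _.
rewrite -(@ler_pXn2r _ 2) ?nnegrE ?mulr_ge0 ?hnorm_ge0//.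
rewrite real_normK ?num_real// exprMn !hnorm_sqr.
have := @cauchy_schwarz_sum R _ xpredT (fun=> 1) a b (fun _ _ => ler01).
under eq_bigr do rewrite mul1r; under [X in _ <= X * _ -> _]eq_bigr do rewrite mul1r.
by under [X in _ <= _ * X -> _]eq_bigr do rewrite mul1r.
Qed.

End IteratedDifferences.

(** * Descent from order [d] to the function itself *)

Section Tower.
Context {R : realType} {n : nat}.
Variable w : cube n -> R.
Hypothesis w_gt0 : forall s, 0 < w s.
Notation E := (mean w).
Context (C beta : R).
Hypothesis C_gt0 : 0 < C.
Hypothesis beta_gt0 : 0 < beta.
Hypothesis rate_ge : forall i s, beta <= rate w i s.
Hypothesis lsi : forall t u, entropy w setT t u <=
  C * \sum_(i in setT) \sum_(s | agree setT t s) w s * diff i u s ^+ 2.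
Notation kappa := (kappa C beta).
Context (d : nat) (f : cube n -> R).
Hypothesis f_mid : forall k, (1 <= k < d)%N -> E (fun s => hnorm k f s ^+ 2) <= 1.
Hypothesis f_top : forall s, hnorm d f s <= 1.

Let q1 k : 1 <= (2 ^ k)%:R :> R.
Proof. by rewrite ler1n expn_gt0. Qed.

(** Induction downwards from the order [d], which is bounded pointwise. Each step feeds the bound
    for one order as gradient bound into [dyadic_moments] for the order below, with [f_mid] as
    second-moment bound, and gains one factor [2 ^ k]. *)
Lemma hnorm_moments j : (j < d)%N -> forall k,
  E (fun s => (hnorm (d - j) f s ^+ 2) ^+ (2 ^ k)) <=
  (((1 + 2 * kappa) * (2 ^ k)%:R) ^+ j) ^+ (2 ^ k).
Proof.
have k0 := kappa_gt0 C_gt0 beta_gt0; move: k0 (@dyadic_moments _ _ _ w_gt0 _ _ C_gt0 beta_gt0 rate_ge lsi).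
move: kappa => K K0 dyadic.
elim: j => [_ k|j IH jd k].
  rewrite subn0 expr0 expr1n -(mean_cst w_gt0 1); apply: (ler_mean w_gt0) => s.
  by rewrite exprn_ile1 ?sqr_ge0// exprn_ile1 ?hnorm_ge0.
have {}IH := IH (ltnW jd).
have a1 l : 1 <= (1 + 2 * K) * (2 ^ l)%:R.
  by rewrite -[leLHS]mulr1 ler_pM// lerDl mulr_ge0// ltW.
have H0 l : 0 < ((1 + 2 * K) * (2 ^ l)%:R) ^+ j by rewrite exprn_gt0// (lt_le_trans ltr01).
have jS : ((d - j.+1).+1 = d - j)%N by rewrite subnSK // ltnW.
apply: le_trans (dyadic _ (fun s => hnorm (d - j) f s ^+ 2) 1 _ _ ler01 H0 _ _ IH k) _.
- by move=> s; rewrite -jS; exact: energy_hnorm.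
- move=> l m lm; rewrite lerXn2r ?nnegrE ?(le_trans ler01)//.
  rewrite ler_wpM2l ?addr_ge0 ?mulr_ge0 ?(ltW K0)// ler_nat leq_pexp2l//.
- by apply: f_mid; rewrite subn_gt0 jd ltn_subrL (leq_trans _ jd).
have h1 : 1 <= ((1 + 2 * K) * (2 ^ k)%:R) ^+ j by rewrite exprn_ege1.
have c0 : 0 <= 1 + 2 * K * (2 ^ k)%:R * ((1 + 2 * K) * (2 ^ k)%:R) ^+ j.
  by rewrite addr_ge0// !mulr_ge0 ?(ltW K0) ?(ltW (H0 _)).
rewrite lerXn2r ?nnegrE// ?exprn_ge0 ?(le_trans ler01)//.
move: h1 (q1 k); rewrite exprS.
move: (((1 + 2 * K) * (2 ^ k)%:R) ^+ j) => y; move: ((2 ^ k)%:R : R) => q y1 q1'.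
(* The summand 1 coming from [f_mid] is absorbed since [q * y] is at least 1. *)
have : 1 * 1 <= q * y by rewrite ler_pM.
by rewrite mulr1; lra.
Qed.

(** The last step of the descent, from order 1 to [f] itself, where the Poincaré inequality supplies
    the second moment. *)
Lemma moments : (0 < d)%N -> forall k,
  E (fun s => ((f s - E f) ^+ 2) ^+ (2 ^ k)) <=
  (((1 + 2 * kappa + 2 * C) * (2 ^ k)%:R) ^+ d) ^+ (2 ^ k).
Proof.
move=> d0 k; have k0 := kappa_gt0 C_gt0 beta_gt0.
have := @hnorm_moments d.-1; rewrite -[X in (_ < X)%N -> _](prednK d0) ltnSn => /(_ isT).
have -> : (d - d.-1)%N = 1%N by rewrite -{1}(prednK d0) subSnn.
move: k0 (@dyadic_moments _ _ _ w_gt0 _ _ C_gt0 beta_gt0 rate_ge lsi).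
move: kappa => K K0 dyadic mom.
have a1 l : 1 <= (1 + 2 * K) * (2 ^ l)%:R.
  by rewrite -[leLHS]mulr1 ler_pM// lerDl mulr_ge0// ltW.
have H0 l : 0 < ((1 + 2 * K) * (2 ^ l)%:R) ^+ d.-1 by rewrite exprn_gt0// (lt_le_trans ltr01).
have Hmono l m : (l <= m)%N -> ((1 + 2 * K) * (2 ^ l)%:R) ^+ d.-1 <= ((1 + 2 * K) * (2 ^ m)%:R) ^+ d.-1.
  move=> lm; rewrite lerXn2r ?nnegrE ?(le_trans ler01)//.
  by rewrite ler_wpM2l ?addr_ge0 ?mulr_ge0 ?(ltW K0)// ler_nat leq_pexp2l.
have eng : energy (fun s => f s - E f) =1 energy f.
  by move=> s; apply: eq_bigr => i _; rewrite /diff; congr (_ ^+ 2); ring.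
(* [Y] may depend on the fixed [k]: the bound on order 1 at exponent [2 ^ 0] is at most the one at
   [2 ^ k], and this choice shares a factor with the gradient term. *)
pose Y := 2 * C * ((1 + 2 * K) * (2 ^ k)%:R) ^+ d.-1.
have Y0 : 0 <= Y by rewrite /Y !mulr_ge0 ?(ltW C_gt0) ?(ltW (H0 _)).
apply: le_trans (dyadic _ (fun s => hnorm 1 f s ^+ 2) Y _ _ Y0 H0 Hmono _ mom k) _.
- by move=> s; rewrite eng energy_hnorm1.
- apply: le_trans (poincare w_gt0 C_gt0 lsi f) _.
  rewrite (eq_mean w (energy_hnorm1 f)) meanZ mulrA [C * 2]mulrC.
  rewrite ler_wpM2l ?mulr_ge0 ?(ltW C_gt0)//.
  by apply: le_trans (Hmono _ _ (leq0n k)); have := mom 0; rewrite expn0 !expr1.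
have L0 : 0 <= Y + 2 * K * (2 ^ k)%:R * ((1 + 2 * K) * (2 ^ k)%:R) ^+ d.-1.
  by rewrite addr_ge0// !mulr_ge0 ?(ltW K0) ?(ltW (H0 _)).
have x0 : 0 <= 1 + 2 * K by rewrite addr_ge0// mulr_ge0// ltW.
have x0' : 0 <= 1 + 2 * K + 2 * C by rewrite addr_ge0// mulr_ge0// ltW.
rewrite lerXn2r ?nnegrE ?exprn_ge0 ?mulr_ge0//.
rewrite -[in leRHS](prednK d0) exprS.
have le1 : ((1 + 2 * K) * (2 ^ k)%:R) ^+ d.-1 <= ((1 + 2 * K + 2 * C) * (2 ^ k)%:R) ^+ d.-1.
  rewrite lerXn2r ?nnegrE ?mulr_ge0// ler_wpM2r// lerDl mulr_ge0// ltW//.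
apply: (@le_trans _ _ ((1 + 2 * K + 2 * C) * (2 ^ k)%:R * ((1 + 2 * K) * (2 ^ k)%:R) ^+ d.-1)); last first.
  by rewrite ler_wpM2l ?mulr_ge0.
rewrite /Y; move: (H0 k) (q1 k).
move: (((1 + 2 * K) * (2 ^ k)%:R) ^+ d.-1) => y; move: ((2 ^ k)%:R : R) => q y0 q1'.
have h1 : 0 <= C * y * (q - 1) by rewrite !mulr_ge0 ?(ltW C_gt0) ?(ltW y0)// subr_ge0.
have h2 : 0 <= q * y by rewrite mulr_ge0 ?(ltW y0)// (le_trans ler01).
by move: h1 h2; lra.
Qed.

End Tower.

(** * Exponential moments *)

Section ExponentialMoment.
Local Open Scope classical_set_scope.
Context {R : realType} {n : nat}.
Variable w : cube n -> R.
Hypothesis w_gt0 : forall s, 0 < w s.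
Notation E := (mean w).

(** The quotient of consecutive left sides is [k.+1%:R * (1 + k%:R^-1) ^+ k], and
    [(1 + k%:R^-1) ^+ k <= expR 1]. *)
Lemma expn_le_fact_expR k : (k%:R ^+ k : R) <= k`!%:R * expR 1 ^+ k.
Proof.
elim: k => [|k IH]; first by rewrite !expr0 fact0 mulr1.
have [->|k0] := posnP k.
  by rewrite !expr1 !mul1r (le_trans _ (expR_ge1Dx 1))// lerDr.
have kR : 0 < k%:R :> R by rewrite ltr0n.
have -> : k.+1%:R ^+ k.+1 = k.+1%:R * (1 + k%:R^-1) ^+ k * k%:R ^+ k :> R.
  rewrite exprS -mulrA -exprMn mulrDl mul1r mulVf ?gt_eqF//.
  by rewrite -natr1.
rewrite factS natrM exprS mulrACA [leRHS](_ : _ = k.+1%:R * expR 1 * (k`!%:R * expR 1 ^+ k)); last by ring.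
rewrite ler_pM ?mulr_ge0 ?exprn_ge0 ?addr_ge0 ?invr_ge0// ler_wpM2l//.
have -> : expR 1 = expR (k%:R^-1) ^+ k :> R.
  by rewrite -expRM_natl mulfV ?gt_eqF.
by rewrite lerXn2r ?nnegrE ?addr_ge0 ?invr_ge0 ?expR_ge0// expR_ge1Dx.
Qed.

(** The mean is a finite sum, so it commutes with the limit of the exponential series. *)
Lemma mean_expR_le (Z : cube n -> R) (a : R) :
  (forall N, E (fun s => \sum_(0 <= k < N) (Z s ^+ k / k`!%:R)) <= a) ->
  E (fun s => expR (Z s)) <= a.
Proof.
move=> H.
have cvgZ s : (fun N => \sum_(0 <= k < N) (Z s ^+ k / k`!%:R)) @ \oo --> expR (Z s).
  exact: (@is_cvg_series_exp_coeff R (Z s)).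
have cvgE : (fun N => E (fun s => \sum_(0 <= k < N) (Z s ^+ k / k`!%:R))) @ \oo -->
    E (fun s => expR (Z s)).
  apply: cvgM; last exact: cvg_cst.
  apply: cvg_big => [|s _]; first exact: add_continuous.
  by apply: cvgM; [exact: cvg_cst|exact: cvgZ].
rewrite -(cvg_lim (@Rhausdorff R) cvgE); apply: limr_le.
  by apply/cvg_ex; eexists; exact: cvgE.
by near=> N; exact: H.
Unshelve. all: by end_near. Qed.

(** In [6 * B * expR 1], a factor 2 pays for rounding exponents up to powers of two, [expR 1] for
    the factorials, and 3 makes the series geometric with ratio [3^-1]. *)
Lemma exp_moment d (Z : cube n -> R) (B : R) : (0 < d)%N -> 0 < B ->
  (forall s, 0 <= Z s) ->
  (forall k, E (fun s => Z s ^+ (d * 2 ^ k)) <= (B * (2 ^ k)%:R) ^+ (d * 2 ^ k)) ->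
  E (fun s => expR ((6 * B * expR 1)^-1 * Z s)) <= 2.
Proof.
move=> d0 B0 Z0 mom; set c := _^-1.
have c0 : 0 < c by rewrite invr_gt0 !mulr_gt0// expR_gt0.
have momk k : (0 < k)%N -> E (fun s => Z s ^+ k) <= 2 * (2 * B * k%:R) ^+ k.
  move=> k0; pose e := up_log 2 k.
  have ke : (k <= 2 ^ e)%N by apply: up_logP.
  have e2k : (2 ^ e <= 2 * k)%N.
    rewrite /e; move: k0; rewrite leq_eqVlt => /orP[/eqP <-//|k1].
    have := up_log_gtn (isT : (1 < 2)%N) k1; have : (0 < up_log 2 k)%N by rewrite up_log_gt0.
    by case: (up_log 2 k) => // e' _ /= /ltnW; rewrite expnS leq_mul2l.
  pose b := B * (2 ^ e)%:R; pose N := (d * 2 ^ e)%N.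
  have b0 : 0 < b by rewrite mulr_gt0// ltr0n expn_gt0.
  have kN : (k <= N)%N by rewrite (leq_trans ke)// leq_pmull.
  have bk : b <= 2 * B * k%:R.
    by rewrite /b -mulrA [2 * _]mulrCA ler_pM2l// -natrM ler_nat.
  apply: (@le_trans _ _ (2 * b ^+ k)); last first.
    by rewrite ler_wpM2l// lerXn2r ?nnegrE ?(ltW b0)// (le_trans (ltW b0)).
  (* Interpolation: [r ^+ k <= 1 + r ^+ N] for [r = b^-1 * Z s], as [k <= N]. *)
  apply: (@le_trans _ _ (E (fun s => b ^+ k + b ^+ k * b^-1 ^+ N * Z s ^+ N))).
    apply: (ler_mean w_gt0) => s.
    have r0 : 0 <= b^-1 * Z s by rewrite mulr_ge0// invr_ge0 ltW.
    have -> : Z s ^+ k = b ^+ k * (b^-1 * Z s) ^+ k.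
      by rewrite -exprMn mulrA divff ?mul1r// gt_eqF.
    rewrite -mulrA -[b^-1 ^+ N * _]exprMn -[X in _ <= X + _]mulr1 -mulrDr ler_wpM2l ?exprn_ge0 ?(ltW b0)//.
    move: (b^-1 * Z s) r0 => r r0; have [r1|/ltW r1] := leP r 1.
      by rewrite (le_trans (exprn_ile1 _ r0 r1))// lerDl exprn_ge0.
    by rewrite (le_trans (ler_weXn2l r1 kN))// lerDr.
  rewrite meanD mean_cst// meanZ mulr_natl mulr2n lerD2l -mulrA ler_piMr ?exprn_ge0 ?(ltW b0)//.
  have -> : 1 = b^-1 ^+ N * b ^+ N by rewrite -exprMn mulVf ?expr1n// gt_eqF.
  by rewrite ler_wpM2l ?exprn_ge0 ?invr_ge0 ?(ltW b0)//; exact: mom.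
apply: mean_expR_le => -[|N].
  by rewrite (eq_mean w (g := fun=> 0)) ?mean_cst// => s; rewrite big_geq.
(* The right side equals 1 plus the sum of [2 * 3^-1 ^+ k] for [1 <= k <= N]. *)
suff H : E (fun s => \sum_(0 <= k < N.+1) ((c * Z s) ^+ k / k`!%:R)) <= 2 - 3^-1 ^+ N.
  by apply: le_trans H _; rewrite gerBl exprn_ge0// invr_ge0.
elim: N => [|N IH].
  rewrite (eq_mean w (g := fun=> 1)) ?mean_cst// => [|s].
    by rewrite expr0; lra.
  by rewrite big_nat1 expr0 fact0 divr1.
have -> : E (fun s => \sum_(0 <= k < N.+2) ((c * Z s) ^+ k / k`!%:R)) =
    E (fun s => \sum_(0 <= k < N.+1) ((c * Z s) ^+ k / k`!%:R))
    + c ^+ N.+1 / N.+1`!%:R * E (fun s => Z s ^+ N.+1).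
  rewrite -meanZ -meanD; apply: eq_mean => s.
  by rewrite big_nat_recr//= exprMn mulrAC.
have f0 : 0 < N.+1`!%:R :> R by rewrite ltr0n fact_gt0.
have term : c ^+ N.+1 / N.+1`!%:R * E (fun s => Z s ^+ N.+1) <= 2 * 3^-1 ^+ N.+1.
  apply: (@le_trans _ _ (c ^+ N.+1 / N.+1`!%:R * (2 * (2 * B * N.+1%:R) ^+ N.+1))).
    by rewrite ler_wpM2l ?momk// divr_ge0 ?exprn_ge0 ?ltW.
  have -> : 3^-1 = 2 * B * c * expR 1 :> R.
    by rewrite /c; field; rewrite !gt_eqF// expR_gt0.
  have -> : c ^+ N.+1 / N.+1`!%:R * (2 * (2 * B * N.+1%:R) ^+ N.+1) =
     2 * ((2 * B * c) ^+ N.+1 * (N.+1%:R ^+ N.+1 / N.+1`!%:R)).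
    by rewrite !exprMn; ring.
  have bc0 : 0 <= (2 * B * c) ^+ N.+1.
    by apply: exprn_ge0; apply: mulr_ge0; [apply: mulr_ge0 => //|]; exact: ltW.
  rewrite ler_wpM2l// [leRHS]exprMn ler_wpM2l//.
  by rewrite ler_pdivrMr// mulrC expn_le_fact_expR.
have E3 : 3^-1 ^+ N = 3 * 3^-1 ^+ N.+1 :> R by rewrite exprS mulrA mulfV ?mul1r// pnatr_eq0.
by move: IH term; rewrite E3; lra.
Qed.

End ExponentialMoment.

(** * The Ising model *)

Section Ising.
Context {R : realType}.

(** Mean value theorem: the derivative is at most [4^-1] in absolute value because
    [(1 - expR c) ^+ 2] is nonnegative. *)
Lemma logistic_lip (x y : R) :
  `|(1 + expR x)^-1 - (1 + expR y)^-1| <= 4^-1 * `|x - y|.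
Proof.
wlog xy : x y / x <= y.
  move=> H; have [|/ltW yx] := leP x y; first exact: H.
  by rewrite distrC [X in _ * X]distrC H.
pose g (z : R) := (1 + expR z)^-1; pose dg (z : R) := - (1 + expR z) ^- 2 * expR z.
have pos z : 0 < 1 + expR z :> R by rewrite addr_gt0// expR_gt0.
have dgE (z : R) : is_derive z 1 g (dg z).
  have h : is_derive z 1 (fun y : R => 1 + expR y) (expR z).
    have h := is_deriveD (is_derive_cst (1 : R) z 1) (is_derive_expR z).
    by rewrite add0r in h.
  exact: (@is_deriveV R (fun y => 1 + expR y) z _ 1 (lt0r_neq0 (pos z)) h).
have [|c _] := MVT_segment xy (fun z _ => dgE z).
  by apply: derivable_within_continuous => z _; exact: ex_derive.
rewrite -/(g x) -/(g y) distrC => ->; rewrite normrM [`|x - y|]distrC ler_wpM2r//.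
rewrite /dg mulNr normrN ger0_norm ?mulr_ge0 ?expR_ge0 ?invr_ge0 ?sqr_ge0//.
rewrite mulrC ler_pdivrMr ?exprn_gt0// -subr_ge0.
have -> : 4^-1 * (1 + expR c) ^+ 2 - expR c = 4^-1 * (1 - expR c) ^+ 2 by field.
by rewrite mulr_ge0 ?sqr_ge0// invr_ge0.
Qed.

Context {n : nat} (J : 'M[R]_n) (h : 'I_n -> R) (alpha alpha' : R).
Hypothesis J_sym : J^T = J.
Hypothesis J_diag : forall i, J i i = 0.
Hypothesis J_row : forall i, \sum_j `|J i j| <= 1 - alpha.
Hypothesis h_bound : forall i, `|h i| <= alpha'.
Hypothesis alpha_ge0 : 0 <= alpha.
Notation w := (ising_weight J h).
Implicit Types (s : cube n) (i j : 'I_n).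

Lemma ising_weight_gt0 s : 0 < w s.
Proof. exact: expR_gt0. Qed.

Definition local_field j s : R := \sum_k J j k * spin R s k + h j.

Lemma spin_flip i s k : spin R (flip i s) k = spin R s k - 2 * spin R s i * (k == i)%:R.
Proof.
rewrite /spin flipE; case: eqP => [->|_]; last by rewrite mulr0 subr0.
by case: (s i) => /=; ring.
Qed.

Lemma normr_spin s i : `|spin R s i| = 1.
Proof. by rewrite /spin; case: (s i); rewrite ?normrN normr1. Qed.

Lemma ising_weight_flip j s :
  w (flip j s) = w s * expR (- (2 * spin R s j * local_field j s)).
Proof.
rewrite /ising_weight -expRD; congr expR.
have JC i k : J i k = J k i by rewrite -{1}J_sym mxE.
have E1 : \sum_i \sum_k J i k * spin R (flip j s) i * spin R (flip j s) k =
    \sum_i \sum_k J i k * spin R s i * spin R s k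
    - 4 * spin R s j * \sum_k J j k * spin R s k.
  (* By [spin_flip] each flipped spin is affine in [delta]; expanding the double sum, [dsum]
     evaluates all the corrections. *)
  pose delta i : R := (i == j)%:R.
  have dsum (G : 'I_n -> R) : \sum_k G k * delta k = G j.
    rewrite (bigD1 j)//= /delta eqxx mulr1 big1 ?addr0// => k kj.
    by rewrite (negbTE kj) mulr0.
  transitivity (\sum_i ((\sum_k J i k * spin R s i * spin R s k)
     - 2 * spin R s j * (J i j * spin R s i)
     - (2 * spin R s j * (\sum_k J i k * spin R s k) - 4 * spin R s j ^+ 2 * J i j) * delta i)).
    apply: eq_bigr => i _.
    transitivity (\sum_k (J i k * spin R s i * spin R s k
        - 2 * spin R s j * (J i k * spin R s i) * delta k
        - (2 * spin R s j * (J i k * spin R s k) - 4 * spin R s j ^+ 2 * J i k * delta k) * delta i)).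
      by apply: eq_bigr => k _; rewrite !spin_flip -/(delta i) -/(delta k); ring.
    by rewrite !sumrB -mulr_suml sumrB !dsum -mulr_sumr.
  rewrite !sumrB dsum J_diag -mulr_sumr.
  have -> : \sum_i J i j * spin R s i = \sum_k J j k * spin R s k.
    by apply: eq_bigr => i _; rewrite JC.
  by ring.
have E2 : \sum_i h i * spin R (flip j s) i = \sum_i h i * spin R s i - 2 * spin R s j * h j.
  transitivity (\sum_i (h i * spin R s i - 2 * spin R s j * h i * (i == j)%:R)).
    by apply: eq_bigr => i _; rewrite spin_flip; ring.
  rewrite sumrB; congr (_ - _); rewrite (bigD1 j)//= eqxx mulr1 big1 ?addr0// => k kj.
  by rewrite (negbTE kj) mulr0.
by rewrite E1 E2 /local_field; field.
Qed.

Lemma ising_rate j s : rate w j s = (1 + expR (2 * spin R s j * local_field j s))^-1.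
Proof.
rewrite /rate ising_weight_flip expRN; set e := expR _.
have e0 : 0 < e by exact: expR_gt0.
have := ising_weight_gt0 s; move: (w s) => x x0.
by field; rewrite !gt_eqF// ?addr_gt0// ?mulr_gt0.
Qed.

(** Flipping [i] moves the argument of the logistic function by [4 * |J i j|], and its slope is at
    most [4^-1]. So the entries of [J] in absolute value serve as Dobrushin matrix. *)
Lemma ising_rate_lip i j s : i != j -> `|rate w j (flip i s) - rate w j s| <= `|J i j|.
Proof.
move=> ij; rewrite !ising_rate; apply: le_trans (logistic_lip _ _) _.
have sj : spin R (flip i s) j = spin R s j by rewrite spin_flip eq_sym (negbTE ij) mulr0 subr0.
have JC : J j i = J i j by rewrite -{1}J_sym mxE.
have -> : local_field j (flip i s) = local_field j s - 2 * spin R s i * J i j.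
  rewrite /local_field.
  transitivity (\sum_k (J j k * spin R s k - 2 * spin R s i * J j k * (k == i)%:R) + h j).
    by congr (_ + _); apply: eq_bigr => k _; rewrite spin_flip; ring.
  have -> : \sum_k (J j k * spin R s k - 2 * spin R s i * J j k * (k == i)%:R) =
      \sum_k J j k * spin R s k - 2 * spin R s i * J i j.
    rewrite sumrB; congr (_ - _); rewrite (bigD1 i)//= eqxx mulr1 JC big1 ?addr0// => k ki.
    by rewrite (negbTE ki) mulr0.
  by ring.
rewrite sj (_ : _ - _ = - (4 * (spin R s j * spin R s i) * J i j)); last by ring.
rewrite normrN normrM [`|4 * _|]normrM [`|spin _ _ _ * _|]normrM !normr_spin !mulr1.
by rewrite normr_nat mulrA mulVf ?mul1r// pnatr_eq0.
Qed.

(** The local field is at most [(1 - alpha) + alpha'] in absolute value, whatever [n] is. *)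
Lemma ising_rate_ge j s : (1 + expR (2 * (1 + alpha')))^-1 <= rate w j s.
Proof.
rewrite ising_rate lef_pV2 ?posrE ?addr_gt0 ?expR_gt0// lerD2l ler_expR.
rewrite -mulrA ler_pM2l//; apply: le_trans (ler_norm _) _.
rewrite normrM normr_spin mul1r /local_field (le_trans (ler_normD _ _))// lerD//.
apply: le_trans (ler_norm_sum _ _ _) _.
apply: (@le_trans _ _ (\sum_k `|J j k|)).
  by apply: ler_sum => k _; rewrite normrM normr_spin mulr1.
by apply: le_trans (J_row j) _; rewrite gerBl.
Qed.

End Ising.

(** * Dimension-free constants and the concentration inequality *)

Theorem theorem1p2 (R : realType) (d : nat) (alpha alpha' : R) :
  (1 <= d)%N -> 0 < alpha <= 1 -> 0 <= alpha' ->
  exists C : R, 0 < C /\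
  forall (n : nat) (J : 'M[R]_n) (h : 'I_n -> R) (f : cube n -> R),
    J^T = J ->
    (forall i, J i i = 0) ->
    (forall i, \sum_j `|J i j| <= 1 - alpha) ->
    (forall i, `|h i| <= alpha') ->
    (forall k, (1 <= k < d)%N -> hL2 J h k f <= 1) ->
    hLinf d f <= 1 ->
    Eq J h (fun s => expR (C * powR `|f s - Eq J h f| (2 / d%:R))) <= 2 /\
    (forall t : R, 0 < t ->
       Pq J h (fun s => t <= `|f s - Eq J h f|)
         <= 2 * expR (- (C * powR t (2 / d%:R)))).
Proof.
move=> d0 /andP[a0 a1] a'0.
(* All constants are fixed before [n], [J], [h] and [f]: [beta] from [ising_rate_ge], [CL] from
   [log_sobolev], and [B] from [moments]. *)
pose beta : R := (1 + expR (2 * (1 + alpha')))^-1.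
have b0 : 0 < beta by rewrite invr_gt0 addr_gt0// expR_gt0.
pose CL : R := (alpha * beta) ^- 2.
have CL0 : 0 < CL by rewrite invr_gt0 exprn_gt0// mulr_gt0.
pose B : R := 1 + 2 * kappa CL beta + 2 * CL.
have B0 : 0 < B.
  have k0 := kappa_gt0 CL0 b0.
  by apply: addr_gt0; [apply: addr_gt0 => //|]; apply: mulr_gt0.
exists (6 * B * expR 1)^-1.
have C0 : 0 < (6 * B * expR 1)^-1.
  by rewrite invr_gt0; apply: mulr_gt0 (expR_gt0 _); apply: mulr_gt0.
split=> // n J h f Jsym Jdiag Jrow hb fmid ftop.
have w0 := ising_weight_gt0 J h.
have lsi := log_sobolev w0 a0 a1 (fun i j => normr_ge0 (J i j))
  (fun i j => congr1 Num.norm (etrans (congr1 (fun M : 'M_n => M i j) (esym Jsym)) (mxE _ _ _ _)))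
  Jrow (ising_rate_lip h Jsym Jdiag) b0 (ising_rate_ge Jsym Jdiag Jrow hb (ltW a0)).
have mid k : (1 <= k < d)%N -> mean (ising_weight J h) (fun s => hnorm k f s ^+ 2) <= 1.
  move=> /fmid; rewrite /hL2 -/(mean _ _) => le1.
  rewrite -[leLHS]sqr_sqrtr ?exprn_ile1 ?sqrtr_ge0//.
  by apply: (mean_ge0 w0) => s; exact: sqr_ge0.
have top s : hnorm d f s <= 1 by apply: le_trans ftop; exact: le_bigmax.
set m := Eq J h f; set Z := fun s => `|f s - m| `^ (2 / d%:R).
have dR : d%:R != 0 :> R by rewrite pnatr_eq0 -lt0n.
(* Turns the even moments of [f - m] into the moments of [Z] of order [d * 2 ^ k] that [exp_moment]
   expects. *)
have Zd s : Z s ^+ d = (f s - m) ^+ 2.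
  rewrite /Z -powR_mulrn ?powR_ge0// -powRrM divfK// powR_mulrn//.
  by rewrite real_normK ?num_real.
have expb : Eq J h (fun s => expR ((6 * B * expR 1)^-1 * Z s)) <= 2.
  apply: (exp_moment w0 d0 B0) => [s|k]; first exact: powR_ge0.
  rewrite exprM; apply: le_trans _ (moments w0 CL0 b0 (ising_rate_ge Jsym Jdiag Jrow hb (ltW a0)) (lsi setT) mid top d0 k).
  rewrite le_eqVlt; apply/orP; left; apply/eqP; apply: eq_mean => s.
  by rewrite exprM Zd.
split=> // t t0.
(* Markov's inequality for the exponential of [Z]. *)
rewrite expRN ler_pdivlMr ?expR_gt0//; apply: le_trans expb.
rewrite /Pq /Eq mulrAC ler_wpM2r ?invr_ge0 ?sumr_ge0// => [s _|]; first exact: ltW.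
rewrite mulr_suml big_mkcond; apply: ler_sum => s _.
case: ifP => [ts|_]; last by rewrite mulr_ge0 ?expR_ge0// ltW.
rewrite ler_pM2l// ler_expR ler_pM2l// ge0_ler_powR ?nnegrE ?divr_ge0 ?(ltW t0)//.
Qed.
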